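(* Determining if a given graph $G$ contains the house as an induced minor can be done in polynomial time (in the size of $G$).
   Context: Graphs are finite, simple and undirected. A graph $H$ is an induced minor of $G$ if a graph isomorphic to $H$ can be obtained from $G$ by a sequence of vertex deletions and edge contractions (loops and parallel edges created by contraction are removed). The house is the graph with vertices $a,b,c,d,e$ and edges $ab,bc,cd,de,ae,ad$. *)

(* Defs.v *)
From mathcomp Require Import all_boot.
Set Implicit Arguments.
Unset Strict Implicit.
Unset Printing Implicit Defensive.

Record sgraph := SGraph {
  vertex :> finType;
  adj : rel vertex;
  adj_sym : symmetric adj;
  adj_irr : irreflexive adj }.

Definition isomorphic (G H : sgraph) : Prop :=
  exists2 f : G -> H, bijective f & forall x y, adj (f x) (f y) = adj x y.

Section Operations.
Variable G : sgraph.

Definition del_adj (v : G) : rel {x : G | x != v} :=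
  fun x y => adj (val x) (val y).

Lemma del_adj_sym v : symmetric (@del_adj v).
Proof. by move=> x y; apply: adj_sym. Qed.

Lemma del_adj_irr v : irreflexive (@del_adj v).
Proof. by move=> x; apply: adj_irr. Qed.

Definition del_vertex (v : G) : sgraph :=
  SGraph (@del_adj_sym v) (@del_adj_irr v).

(* Contraction of the edge uv: the merged vertex is represented by u, and v
   disappears. The test x != y removes the loop. *)
Definition contract_adj (u v : G) : rel {x : G | x != v} :=
  fun x y => (x != y) &&
    [|| adj (val x) (val y),
        (val x == u) && adj v (val y) |
        (val y == u) && adj v (val x)].

Lemma contract_adj_sym u v : symmetric (@contract_adj u v).
Proof.
by move=> x y; rewrite /contract_adj eq_sym adj_sym; congr (_ && (_ || _)); rewrite orbC.
Qed.

Lemma contract_adj_irr u v : irreflexive (@contract_adj u v).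
Proof. by move=> x; rewrite /contract_adj eqxx. Qed.

Definition contract (u v : G) : sgraph :=
  SGraph (@contract_adj_sym u v) (@contract_adj_irr u v).

End Operations.

Inductive induced_minor (H : sgraph) : sgraph -> Prop :=
| Induced_minor_iso (G : sgraph) : isomorphic G H -> induced_minor H G
| Induced_minor_del (G : sgraph) (v : G) :
    induced_minor H (del_vertex v) -> induced_minor H G
| Induced_minor_contract (G : sgraph) (u v : G) :
    adj u v -> induced_minor H (contract u v) -> induced_minor H G.

(* a, b, c, d, e are 0, 1, 2, 3, 4. *)
Definition house_edges : seq (nat * nat) :=
  [:: (0, 1); (1, 2); (2, 3); (3, 4); (0, 4); (0, 3)].

Definition house_adj : rel 'I_5 := fun x y =>
  ((x : nat, y : nat) \in house_edges) || ((y : nat, x : nat) \in house_edges).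

Lemma house_adj_sym : symmetric house_adj.
Proof. by move=> x y; rewrite /house_adj orbC. Qed.

Lemma house_adj_irr : irreflexive house_adj.
Proof. by case; do 5?[case=> //]. Qed.

Definition house : sgraph := SGraph house_adj_sym house_adj_irr.

(* Polynomial time is defined on the random access machine of Cook and Reckhow
   (Time bounded random access machines, 1973), every instruction having unit
   cost. The registers X_0, X_1, ... hold natural numbers and subtraction is
   truncated. Since there is no multiplication, a value computed in t steps has
   O(t) bits, so polynomial time here is polynomial time on Turing machines. *)
Inductive instr :=
| Iconst of nat & nat         (* X_i <- c *)
| Iadd of nat & nat & nat     (* X_i <- X_j + X_k *)
| Isub of nat & nat & nat     (* X_i <- X_j - X_k *)
| Iload of nat & nat          (* X_i <- X_(X_j) *)
| Istore of nat & nat         (* X_(X_i) <- X_j *)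
| Ijump of nat & nat       (* go to instruction m if X_i > 0 *)
| Iread of nat                (* X_i <- next input bit, or 0 past the end *)
| Ihalt of bool.

Definition program := seq instr.

Record config := Config {
  counter : nat;
  regs : nat -> nat;
  input : seq bool }.

Definition upd (r : nat -> nat) (i x : nat) : nat -> nat :=
  fun j => if j == i then x else r j.

Definition step (P : program) (s : config) : config + bool :=
  let: Config pc r w := s in
  match nth (Ihalt false) P pc with
  | Iconst i c => inl (Config pc.+1 (upd r i c) w)
  | Iadd i j k => inl (Config pc.+1 (upd r i (r j + r k)) w)
  | Isub i j k => inl (Config pc.+1 (upd r i (r j - r k)) w)
  | Iload i j => inl (Config pc.+1 (upd r i (r (r j))) w)
  | Istore i j => inl (Config pc.+1 (upd r (r i) (r j)) w)
  | Ijump m i => inl (Config (if 0 < r i then m else pc.+1) r w)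
  | Iread i => inl (Config pc.+1 (upd r i (head false w)) (behead w))
  | Ihalt b => inr b
  end.

Fixpoint run (P : program) (t : nat) (s : config) : option bool :=
  if t is t'.+1 then
    match step P s with
    | inl s' => run P t' s'
    | inr b => Some b
    end
  else None.

Definition init (w : seq bool) : config := Config 0 (fun=> 0) w.

Definition decides_within (P : program) (w : seq bool) (t : nat) (Q : Prop) :=
  exists2 b : bool, run P t (init w) = Some b & (b <-> Q).

Definition polytime_decidable (I : Type) (enc : I -> seq bool)
    (Q : I -> Prop) : Prop :=
  exists (P : program) (c k : nat), forall x : I,
    decides_within P (enc x) (c * size (enc x) ^ k + c) (Q x).

(* The number n of vertices in unary, a 0, then the n * n adjacency matrix row
   by row, the vertices being listed in the order of the enumeration of the
   finite type, which is arbitrary. *)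
Definition encode_graph (G : sgraph) : seq bool :=
  nseq #|G| true ++ false :: [seq adj x y | x <- enum G, y <- enum G].

(* Main.v *)
Require Import Defs.
From mathcomp Require Import all_boot zify.
Set Implicit Arguments.
Unset Strict Implicit.
Unset Printing Implicit Defensive.

(* A graph G contains the house as an induced minor if and only if there are
   vertices b, c, x, p, q such that c and x are nonadjacent neighbours of b, p
   and q are distinct neighbours of x in one component of G - N[b], that
   component contains a neighbour of c, and p is not adjacent to c. Such
   vertices are found by exhaustive search and graph reachability.

   Given branch sets A, ..., E of the house, one can move vertices between them,
   and rotate them along the cycle through B and C, until A = {x}, B = {b} and
   C = {c}; then a neighbour p of x in E and a neighbour q of x in D are as
   required. Conversely, let K be the component of p in G - N[b] - N[c] and y a
   neighbour of c in G - N[b] with a neighbour in K. If x and y are adjacent,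
   the branch sets are {x}, {b}, {c}, {y}, K. If q is in K, one splits K into
   two connected parts containing p and q, and adds y to one of them. Otherwise
   let L be the component of q in G - N[b] - K - y; the branch sets are {x}, {b},
   {c}, {y} + L, K if y has a neighbour in L, and {c}, {y}, K, {x} + L, {b} if c
   has one. *)

(** * Connected sets *)

Section Sets.
Variable G : sgraph.
Implicit Types (x y : G) (A B C D P : {set G}).

(** Connectedness as an induction principle: a set that meets [A] and is closed under adjacency
    within [A] contains [A]. Nonemptiness is included because branch sets are nonempty. *)
Definition conn A : Prop :=
  (exists x, x \in A) /\
  forall S : {set G}, (exists2 x, x \in A & x \in S) ->
    (forall x y, x \in A -> y \in A -> adj x y -> x \in S -> y \in S) ->
    {subset A <= S}.

Definition sep A B : bool := [disjoint A & B].

Definition touch A B : bool := [exists x in A, exists y in B, adj x y].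

Lemma touchP A B :
  reflect (exists x y, [/\ x \in A, y \in B & adj x y]) (touch A B).
Proof.
apply: (iffP exists_inP) => [[x xA /exists_inP[y yB xy]]|[x [y [xA yB xy]]]].
  by exists x, y.
by exists x => //; apply/exists_inP; exists y.
Qed.

Lemma touchC A B : touch A B = touch B A.
Proof. by apply/touchP/touchP => -[x [y [*]]]; exists y, x; split=> //; rewrite adj_sym. Qed.

Lemma touchUl A B C : touch (A :|: B) C = touch A C || touch B C.
Proof.
apply/touchP/orP => [[x [y [/setUP[xA|xB] yC xy]]]|[]/touchP[x [y [xA yC xy]]]].
- by left; apply/touchP; exists x, y.
- by right; apply/touchP; exists x, y.
- by exists x, y; rewrite inE xA.
- by exists x, y; rewrite inE xA orbT.
Qed.

Lemma touchUr A B C : touch C (A :|: B) = touch C A || touch C B.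
Proof. by rewrite touchC touchUl !(touchC C). Qed.

Lemma touch1 x y : touch [set x] [set y] = adj x y.
Proof.
apply/touchP/idP => [[u [v [/set1P-> /set1P->]]] //|xy].
by exists x, y; rewrite !inE.
Qed.

Lemma touch_mem A B x y : x \in A -> y \in B -> adj x y -> touch A B.
Proof. by move=> xA yB xy; apply/touchP; exists x, y. Qed.

Lemma touchS A B A' B' : A' \subset A -> B' \subset B -> touch A' B' -> touch A B.
Proof.
by move=> /subsetP AA /subsetP BB /touchP[x [y [/AA xA /BB yB xy]]]; exact: touch_mem xy.
Qed.

Lemma sepC A B : sep A B = sep B A. Proof. exact: disjoint_sym. Qed.

Lemma sepUl A B C : sep (A :|: B) C = sep A C && sep B C.
Proof. by rewrite /sep -!setI_eq0 setIUl setU_eq0. Qed.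

Lemma sepUr A B C : sep C (A :|: B) = sep C A && sep C B.
Proof. by rewrite sepC sepUl !(sepC C). Qed.

Lemma sep1 x A : sep [set x] A = (x \notin A).
Proof. by rewrite /sep disjoints1. Qed.

Lemma sepS A B A' B' : A' \subset A -> B' \subset B -> sep A B -> sep A' B'.
Proof. by move=> AA BB sAB; apply: disjointWl AA (disjointWr BB sAB). Qed.

Lemma conn1 x : conn [set x].
Proof.
split=> [|S [y /set1P-> xS] _ z /set1P-> //].
by exists x; rewrite inE.
Qed.

Lemma connU A B : conn A -> conn B -> touch A B -> conn (A :|: B).
Proof.
move=> [[a aA] cA] [_ cB] /touchP[u [v [uA vB uv]]]; split.
  by exists a; rewrite inE aA.
move=> S [x xAB xS] clS.
have half A' (cA' : forall S : {set G}, (exists2 x, x \in A' & x \in S) ->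
    (forall x y, x \in A' -> y \in A' -> adj x y -> x \in S -> y \in S) ->
    {subset A' <= S}) : A' \subset A :|: B -> forall z, z \in A' -> z \in S -> {subset A' <= S}.
  move=> /subsetP sub z zA zS; apply: cA'; first by exists z.
  by move=> y y' /sub yA /sub y'A; apply: clS.
have hA := half A cA (subsetUl A B); have hB := half B cB (subsetUr A B).
have uS : u \in S.
  case/setUP: xAB => [xA|xB]; first exact: hA xA xS u uA.
  apply: (clS v); rewrite ?inE ?uA ?vB ?orbT //; first by rewrite adj_sym.
  exact: hB xB xS v vB.
have vS : v \in S by apply: (clS u); rewrite ?inE ?uA ?vB ?orbT.
by move=> z /setUP[/(hA u uA uS)|/(hB v vB vS)].
Qed.

(** Both ends of an edge must lie in [P], so for [x] outside [P] this is just [[set x]]. The lock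
    keeps simplification from unfolding [connect]. *)
Definition component P x : {set G} :=
  locked [set y | connect (fun u v => [&& adj u v, u \in P & v \in P]) x y].

Lemma in_component P x y :
  (y \in component P x) = connect (fun u v => [&& adj u v, u \in P & v \in P]) x y.
Proof. by rewrite /component -lock inE. Qed.

Lemma component_refl P x : x \in component P x. Proof. by rewrite in_component connect0. Qed.

Lemma component_sym P x y : (x \in component P y) = (y \in component P x).
Proof.
rewrite !in_component; apply: sym_connect_sym => u v.
by rewrite adj_sym; congr (_ && _); rewrite andbC.
Qed.

Lemma component_closed P x u v :
  u \in component P x -> u \in P -> v \in P -> adj u v -> v \in component P x.
Proof.
by rewrite !in_component => xu uP vP uv; apply: connect_trans xu (connect1 _); rewrite uv uP.
Qed.

Lemma component_ind P x (S : {set G}) : x \in S ->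
  (forall u v, u \in S -> u \in P -> v \in P -> adj u v -> v \in S) -> component P x \subset S.
Proof.
move=> xS clS; apply/subsetP => y; rewrite in_component => /connectP[q qp ->].
elim: q x xS qp => //= z q IH x xS /andP[/and3P[xz xP zP] qp].
by apply: IH qp; apply: clS xz.
Qed.

Lemma component_sub P x : x \in P -> component P x \subset P.
Proof. by move=> xP; apply: component_ind. Qed.

Lemma component_conn P x : x \in P -> conn (component P x).
Proof.
move=> xP; have /subsetP sub := component_sub xP.
split=> [|S [y yK yS] clS]; first by exists x; exact: component_refl.
(* A closed set [S] that contains [z] contains the component of [z]. This is used twice: from [y] to
   reach [x], then from [x] to reach the rest. *)
have reach z : z \in component P x -> z \in S -> component P z \subset S :&: component P x.
  move=> zK zS; apply: component_ind; first by rewrite inE zS.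
  move=> u v /setIP[uS uK] uP vP uv; rewrite inE.
  have vK := component_closed uK uP vP uv; rewrite vK andbT; exact: clS uv uS.
have xS : x \in S.
  have /subsetP/(_ x) := reach y yK yS.
  by rewrite component_sym yK => /(_ isT) /setIP[].
by move=> z zK; have /subsetP/(_ z zK)/setIP[] := reach x (component_refl P x) xS.
Qed.

Lemma conn_component A P x : conn A -> A \subset P -> x \in A -> A \subset component P x.
Proof.
move=> [_ cA] /subsetP AP xA; apply/subsetP; apply: cA.
  by exists x => //; exact: component_refl.
by move=> u v /AP uP /AP vP uv uK; apply: component_closed uv.
Qed.

(* One part is the component of x in A - y; the rest is connected because each
   of its components contains y. *)
Lemma conn_split A x y : conn A -> x \in A -> y \in A -> x != y ->
  exists A1 A2 : {set G}, [/\ conn A1 /\ conn A2, x \in A1 /\ y \in A2, A = A1 :|: A2,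
    sep A1 A2 & touch A1 A2].
Proof.
move=> [_ cA] xA yA xy.
pose P := A :\ y; pose A1 := component P x; pose A2 := A :\: A1.
have xP : x \in P by rewrite !inE xy.
have /subsetP A1P : A1 \subset P := component_sub xP.
have A1A u : u \in A1 -> u \in A by move/A1P/setD1P => [].
have yA1 : y \notin A1 by apply/negP => /A1P; rewrite !inE eqxx.
(* Since [A1] is a component of [A] minus [y], an edge from it to the rest of [A] can only end in
   [y]. *)
have leave u v : u \in A1 -> v \in A2 -> adj u v -> v = y.
  move=> uA1 /setDP[vA vA1] uv; apply/eqP; apply: contraNT vA1 => vy.
  by apply: (component_closed uA1 (A1P u uA1) _ uv); rewrite !inE vy.
have yA2 : y \in A2 by rewrite inE yA1.
(* A nonempty closed part of [A2] avoiding [y] would be closed in all of [A], hence contain [y]. *)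
have y_in (S : {set G}) : (exists2 u, u \in A2 & u \in S) ->
    (forall u v, u \in A2 -> v \in A2 -> adj u v -> u \in S -> v \in S) -> y \in S.
  move=> [u uA2 uS] clS; apply: contraT => yS.
  have sub : {subset A <= S :&: A2}.
    apply: cA; first by exists u; [case/setDP: uA2 | rewrite in_setI uS].
    move=> v w vA wA vw /setIP[vS vA2]; rewrite in_setI.
    have wA2 : w \in A2.
      rewrite inE wA andbT; apply/negP => wA1.
      by move: yS; rewrite -(leave w v wA1 vA2) ?vS // adj_sym.
    by rewrite wA2 andbT; exact: clS vA2 wA2 vw vS.
  by have := sub y yA; rewrite inE (negPf yS).
exists A1, A2; split.
- split; first exact: component_conn.
  split=> [|S SA2 clS]; first by exists y.
  have yS := y_in S SA2 clS.
  (* If [z] is not in [S], the complement of [S] is closed in [A2] as well, so [y] lies in both. *)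
  move=> z zA2; apply: contraT => zS.
  suff : y \in ~: S by rewrite inE yS.
  apply: y_in; first by exists z; rewrite // in_setC.
  move=> u v uA2 vA2 uv; rewrite !in_setC; apply: contra => vS.
  by apply: (clS v u) => //; rewrite adj_sym.
- by split=> //; exact: component_refl.
- by apply/setP => z; rewrite !inE; case: (boolP (z \in A1)) => // /A1A ->.
- by rewrite /sep -setI_eq0; apply/eqP/setP => z; rewrite !inE; case: (z \in A1).
- apply: contraT => nt; have sub : {subset A <= A1}.
    apply: cA; first by exists x => //; exact: component_refl.
    move=> u v uA vA uv uA1; apply: contraT => vA1; case/negP: nt.
    by apply: touch_mem uv; rewrite // inE vA1.
  by move: yA1; rewrite sub.
Qed.

(* X consists of the vertices of C joined to D by paths avoiding the
   neighbourhood of B. *)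
Lemma conn_absorb B C D : conn C -> conn D -> touch C D -> touch B C -> sep C D ->
  exists c (X : {set G}), [/\ c \in C, X \subset C :\ c, conn (D :|: X), touch [set c] (D :|: X)
                & touch B [set c] /\ ~~ touch B X].
Proof.
move=> cC cD tCD tBC sCD; have [[d dD] _] := cD.
pose C' := [set u in C | ~~ touch B [set u]].
pose T := component (C' :|: D) d.
have dP : d \in C' :|: D by rewrite inE dD orbT.
have /subsetP TP : T \subset C' :|: D := component_sub dP.
have DT : D \subset T by apply: conn_component; rewrite ?subsetUr.
have TE : D :|: (T :\: D) = T
  by apply/setP => u; rewrite !inE; case: (boolP (u \in D)) => //= /(subsetP DT) ->.
have X_sub u : u \in T :\: D -> u \in C'.
  by case/setDP => /TP /setUP[//|->].
(* If no vertex of [C] with a neighbour in [B] touches [T], then [T] is closed in the connected set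
   [C :|: D] and contains it; but [T] omits [c0], a vertex of [C] with a neighbour in [B]. *)
have [c [cC1 Bc cT]] : exists c, [/\ c \in C, touch B [set c] & touch [set c] T].
  case/touchP: (tBC) => b [c0 [bB c0C bc0]].
  have Bc0 : touch B [set c0] by apply: touch_mem bc0; rewrite ?inE.
  case: (boolP [exists c in C, touch B [set c] && touch [set c] T])
    => [/exists_inP[c cC1 /andP[]]|no].
    by exists c.
  have [_ cCD] := connU cC cD tCD.
  have sub : {subset C :|: D <= T}.
    apply: cCD; first by exists d; rewrite ?inE ?dD ?orbT //; apply: component_refl.
    move=> u v _ vCD uv uT; apply: contraT => vT.
    case/setUP: vCD => [vC|vD]; last by rewrite (subsetP DT) in vT.
    case: (boolP (touch B [set v])) => [Bv|nBv].
      case/exists_inP: no; exists v => //; rewrite Bv touchC.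
      by apply: touch_mem uv; rewrite ?inE.
    by case/negP: vT; apply: (component_closed uT (TP u uT) _ uv); rewrite !inE vC nBv.
  have /TP : c0 \in T by apply: sub; rewrite inE c0C.
  case/setUP; first by rewrite inE Bc0 andbF.
  by rewrite (disjointFr sCD c0C).
exists c, (T :\: D); rewrite TE; split=> //.
- apply/subsetP => u /X_sub; rewrite !inE => /andP[-> nBu]; rewrite andbT.
  by apply: contraNneq nBu => ->.
- exact: component_conn.
- split=> //; apply/negP => /touchP[b [u [bB /X_sub uC' bu]]].
  by move: uC'; rewrite inE => /andP[_ /negP[]]; apply: touch_mem bu; rewrite ?inE.
Qed.

End Sets.

(** * Branch sets *)

Definition branch (G H : sgraph) (f : G -> option H) (h : H) : {set G} :=
  [set x | f x == Some h].

Lemma in_branch (G H : sgraph) (f : G -> option H) h x :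
  (x \in branch f h) = (f x == Some h).
Proof. by rewrite inE. Qed.

(* The vertices sent to None are deleted, and each branch set is contracted. *)
Definition minor_map (G H : sgraph) (f : G -> option H) : Prop :=
  (forall h, conn (branch f h)) /\
  (forall h h', h != h' -> touch (branch f h) (branch f h') = adj h h').

(** Preimages of connected sets are connected: a set closed in the preimage contains every fibre
    that it meets, and adjacent vertices have touching fibres. *)
Lemma minor_map_comp (G1 G2 H : sgraph) (q : G1 -> option G2) (f : G2 -> option H) :
  minor_map q -> minor_map f -> minor_map (fun x => obind f (q x)).
Proof.
move=> [cq aq] [cf af]; set qf := fun x => _.
have qf_in h x p : q x = Some p -> (x \in branch qf h) = (p \in branch f h).
  by move=> qx; rewrite !in_branch /qf qx.
split=> [h|h h' hh'].
  have [[p pf] clf] := cf h; split.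
    by have [[x]] := cq p; rewrite in_branch => /eqP qx _; exists x; rewrite (qf_in _ _ _ qx).
  move=> S [x xf xS] clS.
  pose S' := [set p | branch q p \subset S].
  have fibre p0 y : p0 \in branch f h -> q y = Some p0 -> y \in S -> p0 \in S'.
    move=> p0f qy yS; rewrite inE; apply/subsetP; have [_ ] := cq p0; apply.
      by exists y; rewrite ?in_branch ?qy.
    move=> u v; rewrite !in_branch => /eqP qu /eqP qv; apply: clS.
      by rewrite (qf_in _ _ _ qu).
    by rewrite (qf_in _ _ _ qv).
  have sub : {subset branch f h <= S'}.
    apply: clf.
      move: xf; rewrite in_branch /qf; case E: (q x) => [p0|] //= fp0.
      by exists p0; rewrite ?in_branch //; apply: fibre E xS; rewrite in_branch.
    move=> u v uf vf uv; rewrite inE => /subsetP uS.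
    have ne : u != v by apply: contraTneq uv => ->; rewrite adj_irr.
    have /touchP[y [z [yu zv yz]]] : touch (branch q u) (branch q v) by rewrite aq.
    move: (yu) (zv); rewrite !in_branch => /eqP qy /eqP qz.
    apply: (fibre v z) => //; apply: (clS y z) => //; last exact: uS.
      by rewrite (qf_in _ _ _ qy).
    by rewrite (qf_in _ _ _ qz).
  move=> z; rewrite in_branch /qf; case E: (q z) => [p0|] //= fp0.
  have : p0 \in S' by apply: sub; rewrite in_branch.
  by rewrite inE => /subsetP; apply; rewrite in_branch E.
rewrite -af //; apply/touchP/touchP => [[x [y [xh yh xy]]]|[u [v [uh vh uv]]]].
  move: xh yh; rewrite !in_branch /qf.
  case Ex: (q x) => [u|] //= fu; case Ey: (q y) => [v|] //= fv.
  exists u, v; rewrite !in_branch; split=> //.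
  have ne : u != v.
    by apply: contraNneq hh' => uv; move: fu; rewrite uv (eqP fv) => /eqP[->].
  by rewrite -aq //; apply: touch_mem xy; rewrite in_branch ?Ex ?Ey.
have ne : u != v by apply: contraTneq uv => ->; rewrite adj_irr.
have /touchP[y [z [yu zv yz]]] : touch (branch q u) (branch q v) by rewrite aq.
move: yu zv; rewrite !in_branch => /eqP qy /eqP qz.
by exists y, z; rewrite (qf_in _ _ _ qy) (qf_in _ _ _ qz).
Qed.

(** Passes branch sets down to the graph after one deletion or contraction: [f] is constant on the
    fibres of [q], and images of connected unions of fibres are connected. *)
Lemma minor_map_factor (G1 G2 H : sgraph) (q : G1 -> option G2) (f : G1 -> option H)
    (f' : G2 -> option H) :
  minor_map q -> minor_map f -> (forall x, f x = obind f' (q x)) -> minor_map f'.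
Proof.
move=> [cq aq] [cf af] fE.
have lift p : exists x, q x = Some p.
  by have [[x]] := cq p; rewrite in_branch => /eqP qx _; exists x.
have f_in h x p : q x = Some p -> (x \in branch f h) = (p \in branch f' h).
  by move=> qx; rewrite !in_branch fE qx.
have f_q h x : x \in branch f h -> exists2 p, q x = Some p & p \in branch f' h.
  by rewrite in_branch fE; case E: (q x) => [p|] //= fp; exists p; rewrite ?in_branch.
split=> [h|h h' hh'].
  have [[x xf] clf] := cf h; split.
    by have [p _ pf] := f_q h x xf; exists p.
  move=> S [p pf pS] clS.
  pose S' := [set x | if q x is Some p then p \in S else false].
  have sub : {subset branch f h <= S'}.
    apply: clf.
      by have [y qy] := lift p; exists y; rewrite ?(f_in _ _ _ qy) // inE qy.
    move=> u v /f_q[pu qu puf] /f_q[pv qv pvf] uv; rewrite !inE qu qv => puS.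
    have [<-//|ne] := eqVneq pu pv; apply: clS puS => //.
    by rewrite -aq //; apply: touch_mem uv; rewrite in_branch ?qu ?qv.
  move=> p' p'f; have [y qy] := lift p'.
  have : y \in S' by apply: sub; rewrite (f_in _ _ _ qy).
  by rewrite inE qy.
rewrite -af //; apply/touchP/touchP => [[u [v [uh vh uv]]]|[x [y [xh yh xy]]]].
  have ne : u != v by apply: contraTneq uv => ->; rewrite adj_irr.
  have /touchP[y [z [yu zv yz]]] : touch (branch q u) (branch q v) by rewrite aq.
  move: yu zv; rewrite !in_branch => /eqP qy /eqP qz.
  by exists y, z; rewrite (f_in _ _ _ qy) (f_in _ _ _ qz).
have [u qx uh] := f_q h x xh; have [v qy vh] := f_q h' y yh.
exists u, v; split=> //; have ne : u != v.
  apply: contraNneq hh' => uv; move: uh vh.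
  by rewrite uv !in_branch => /eqP-> /eqP[->].
by rewrite -aq //; apply: touch_mem xy; rewrite in_branch ?qx ?qy.
Qed.

Lemma minor_map_iso (G H : sgraph) (f : G -> H) :
  bijective f -> (forall x y, adj (f x) (f y) = adj x y) -> minor_map (fun x => Some (f x)).
Proof.
move=> [g fK gK] fadj.
have E h : branch (fun x => Some (f x)) h = [set g h].
  apply/setP => x; rewrite in_branch inE; apply/eqP/eqP => [[<-]|->]; first by rewrite fK.
  by rewrite gK.
split=> [h|h h' _]; rewrite !E; first exact: conn1.
by rewrite touch1 -fadj !gK.
Qed.

Lemma minor_map_del (G : sgraph) (v : G) :
  minor_map (fun x => insub x : option (del_vertex v)).
Proof.
have E h : branch (fun x => insub x : option (del_vertex v)) h = [set val h].
  apply/setP => x; rewrite in_branch inE; apply/eqP/eqP => [|->]; last by rewrite valK.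
  by case: insubP => // u _ <- [->].
by split=> [h|h h' _]; rewrite !E; [exact: conn1 | rewrite touch1].
Qed.

Lemma minor_map_contract (G : sgraph) (u v : G) : adj u v ->
  minor_map (fun x => insub (if x == v then u else x) : option (contract u v)).
Proof.
move=> uv; have nuv : u != v by apply: contraTneq uv => ->; rewrite adj_irr.
pose q (x : G) : option (contract u v) := insub (if x == v then u else x).
change (minor_map q).
have E (h : contract u v) : branch q h = if val h == u then [set u; v] else [set val h].
  apply/setP => x; rewrite in_branch /q; set y := if _ then _ else _.
  have yv : y != v by rewrite /y; case: ifP => // /negbT.
  rewrite insubT /= (inj_eq (@Some_inj _)) -val_eqE /= /y.
  move: (valP h) => /=; set w := sval h => wv.
  case: (eqVneq x v) => [->|xv]; case: (eqVneq w u) => [wE|wu]; rewrite !inE ?wE.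
  - by rewrite eqxx orbT.
  - by rewrite eq_sym (negPf wv).
  - by rewrite (negPf xv) orbF.
  - by [].
split=> [h|h h' hh'].
  rewrite E; case: ifP => _; last exact: conn1.
  by apply: connU; rewrite ?touch1 //; exact: conn1.
rewrite !E /= /contract_adj hh' /=.
case: (eqVneq (val h) u) => [hu|_]; case: (eqVneq (val h') u) => [h'u|_].
- by case/eqP: hh'; apply: val_inj; rewrite hu.
- by rewrite -hu touchUl !touch1 orbF.
- by rewrite -h'u touchUr !touch1 /= (adj_sym v).
- by rewrite touch1 !orbF.
Qed.

Lemma minor_map_of_induced_minor (G H : sgraph) : induced_minor H G ->
  exists f : G -> option H, minor_map f.
Proof.
elim=> {G} [G [f bf fadj]|G v _ [f mf]|G u v uv _ [f mf]].
- by exists (fun x => Some (f x)); apply: minor_map_iso.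
- eexists; exact: minor_map_comp (minor_map_del v) mf.
- eexists; exact: minor_map_comp (minor_map_contract uv) mf.
Qed.

(** Induction on the number of vertices: delete a vertex sent to [None]; failing that, contract an
    edge inside a branch set; failing both, every branch set is a single vertex and the map is an
    isomorphism. *)
Lemma induced_minor_of_minor_map (G H : sgraph) (f : G -> option H) :
  minor_map f -> induced_minor H G.
Proof.
have [n] := ubnP #|G|; elim: n G f => // n IH G f Gn mf.
have small (v : G) : #|{: {x : G | x != v}}| < n.
  rewrite card_sig (eq_card (B := predC1 v)) // cardC1.
  have : 0 < #|G| by apply/card_gt0P; exists v.
  by case: #|G| Gn.
case: (pickP (fun v => f v == None)) => [v /eqP fv|f_some].
  apply: (@Induced_minor_del _ G v).
  apply: (IH (del_vertex v) (f \o val) (small v)).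
  apply: minor_map_factor (minor_map_del v) mf _ => x.
  by case: insubP => /= [u _ <-//|]; rewrite negbK => /eqP->.
case: (pickP (fun p : G * G => adj p.1 p.2 && (f p.1 == f p.2)))
  => [[u v] /= /andP[uv /eqP fuv]|no_edge].
  apply: (@Induced_minor_contract _ G u v uv).
  apply: (IH (contract u v) (f \o val) (small v)).
  apply: minor_map_factor (minor_map_contract uv) mf _ => x.
  case: insubP => /= [w _ ->|]; first by case: eqP => // ->.
  rewrite negbK; case: (eqVneq x v) => [->|xv] /eqP //.
    by move=> uE; rewrite uE adj_irr in uv.
  by move=> xv'; rewrite xv' eqxx in xv.
have [cf af] := mf.
have fS x : {h | f x = Some h}.
  by move: (f_some x); case: (f x) => [h|//] _; exists h.
pose g x := sval (fS x); have gE x : f x = Some (g x) by rewrite /g; case: (fS x).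
(* A branch set without inner edges is a single vertex, since [[set x]] is closed in it. *)
have g_inj : injective g.
  move=> x y gxy; have [_ /(_ [set x])] := cf (g x).
  have xg : x \in branch f (g x) by rewrite in_branch gE.
  have yg : y \in branch f (g x) by rewrite in_branch gE gxy.
  move=> cl; suff : {subset branch f (g x) <= [set x]} by move/(_ y yg)/set1P.
  apply: cl; first by exists x => //; rewrite inE.
  move=> u v; rewrite !in_branch => /eqP fu /eqP fv uv _.
  by have := no_edge (u, v); rewrite /= uv fu fv eqxx.
have g_surj h : exists x, g x = h.
  by have [[x]] := cf h; rewrite in_branch gE => /eqP[<-] _; exists x.
apply: Induced_minor_iso; exists g.
  have g_surjb h : exists x, g x == h by have [x <-] := g_surj h; exists x.
  exists (fun h => xchoose (g_surjb h)) => [x|h]; last exact/eqP/(xchooseP (g_surjb h)).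
  by apply: g_inj; apply/eqP/(xchooseP (g_surjb (g x))).
move=> x y; have [->|ne] := eqVneq x y; first by rewrite !adj_irr.
have E z : branch f (g z) = [set z].
  by apply/setP => w; rewrite in_branch gE inE (inj_eq (@Some_inj _)) (inj_eq g_inj).
by rewrite -af ?(inj_eq g_inj) // !E touch1.
Qed.

(** * The house *)

Section House.
Variable G : sgraph.
Implicit Types (x y : G) (A B C D E P X : {set G}).

Definition near A B : bool := sep A B && touch A B.

Definition far A B : bool := sep A B && ~~ touch A B.

(** These tactics break [near] and [far] of unions into conditions on the parts and look each one up
    among the hypotheses, up to symmetry. *)
Ltac unpack := rewrite /near /far; repeat match goal with
  | H : is_true (_ && _) |- _ => let H1 := fresh "H" in let H2 := fresh "H" in
      case/andP: H => H1 H2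
  | H : is_true (~~ (_ || _)) |- _ => rewrite negb_or in H
  | H : is_true (near _ _) |- _ => rewrite /near in H
  | H : is_true (far _ _) |- _ => rewrite /far in H
  | H : is_true (sep (_ :|: _) _) |- _ => rewrite sepUl in H
  | H : is_true (sep _ (_ :|: _)) |- _ => rewrite sepUr in H
  | H : context [touch (_ :|: _) _] |- _ => rewrite touchUl in H
  | H : context [touch _ (_ :|: _)] |- _ => rewrite touchUr in H
  end.

Ltac atom := first
  [ assumption
  | rewrite sepC; assumption
  | rewrite touchC; assumption
  | apply/orP; left; atom
  | apply/orP; right; atom ].

Ltac atoms := unpack; rewrite ?sepUl ?sepUr ?touchUl ?touchUr ?negb_or;
  repeat (apply/andP; split); atom.

(** The sets [A], [B], [C], [D] form the square in this cyclic order, and [E] is the roof over the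
    side from [A] to [D]. *)
Definition house_model A B C D E : Prop :=
  [/\ conn A /\ conn B, conn C /\ conn D, conn E,
      [&& near A B, near B C, near C D, near A D, near D E & near A E]
    & [&& far A C, far B D, far B E & far C E]].

(** The reflection of the house, which fixes the roof. *)
Lemma house_model_sym A B C D E : house_model A B C D E -> house_model D C B A E.
Proof.
by move=> [[cA cB] [cC cD] cE nears fars]; split=> //; atoms.
Qed.

Lemma minor_map_of_house_model A B C D E : house_model A B C D E ->
  exists f : G -> option house, minor_map f.
Proof.
move=> [[cA cB] [cC cD] cE nears fars].
pose F (h : house) := nth set0 [:: A; B; C; D; E] (h : 'I_5).
have FP h h' : h != h' -> sep (F h) (F h') && (touch (F h) (F h') == adj h h').
  move: nears fars; rewrite /near /far.
  move=> /and5P[/andP[s1 t1] /andP[s2 t2] /andP[s3 t3] /andP[s4 t4]].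
  move=> /andP[/andP[s5 t5] /andP[s6 t6]].
  move=> /and4P[/andP[s7 t7] /andP[s8 t8] /andP[s9 t9] /andP[s10 t10]].
  rewrite /F; case: h h' => [[|[|[|[|[|?]]]]] ?] [[|[|[|[|[|?]]]]] ?] //= _;
  try (rewrite sepC touchC; by apply/andP; split; [assumption |
    apply/eqP; first [assumption | apply/negbTE; assumption]]);
  by apply/andP; split; [assumption |
    apply/eqP; first [assumption | apply/negbTE; assumption]].
pose f x := [pick h | x \in F h].
have E' h : branch f h = F h.
  apply/setP => x; rewrite in_branch /f; case: pickP => [h' xh'|no]; last by rewrite no.
  rewrite (inj_eq (@Some_inj _)); have [<-//|ne] := eqVneq h' h.
  have /andP[s _] := FP h' h ne; by rewrite (disjointFr s xh').
exists f; split=> [h|h h' ne]; rewrite !E'; last by case/andP: (FP h h' ne) => _ /eqP.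
by case: h => [[|[|[|[|[|?]]]]] ?].
Qed.

Lemma house_model_of_minor_map (f : G -> option house) : minor_map f ->
  exists A B C D E, house_model A B C D E.
Proof.
move=> [cf af].
have nearP h h' : h != h' -> adj h h' -> near (branch f h) (branch f h').
  move=> ne hh'; rewrite /near af // hh' andbT /sep -setI_eq0; apply/eqP/setP => x.
  rewrite in_setI !in_branch in_set0; apply/negbTE; apply: contra ne.
  by case/andP => /eqP-> /eqP[->].
have farP h h' : h != h' -> ~~ adj h h' -> far (branch f h) (branch f h').
  move=> ne hh'; rewrite /far af // hh' andbT /sep -setI_eq0; apply/eqP/setP => x.
  rewrite in_setI !in_branch in_set0; apply/negbTE; apply: contra ne.
  by case/andP => /eqP-> /eqP[->].
pose o i (i5 : i < 5) : house := Ordinal i5.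
exists (branch f (o 0 isT)), (branch f (o 1 isT)), (branch f (o 2 isT)),
  (branch f (o 3 isT)), (branch f (o 4 isT)).
by split; rewrite ?nearP ?farP.
Qed.

(** By [conn_absorb], [C] shrinks to a vertex [c] with a neighbour in [B], [D] absorbs [X], and the
    rest of [C] is dropped. The set [X] does not touch [B] and, lying in [C], stays far from [A] and
    [E]. *)
Lemma house_model_shrink A B C D E : house_model A B C D E ->
  exists c X, [/\ c \in C, X \subset C :\ c & house_model A B [set c] (D :|: X) E].
Proof.
move=> [[cA cB] [cC cD] cE nears fars]; unpack.
have [|||c [X [cC' XC cDX tc [tBc tBX]]]] := @conn_absorb G B C D cC cD; try atom.
exists c, X; split=> //.
have scX : sep [set c] X by rewrite sep1; apply/negP => /(subsetP XC); rewrite !inE eqxx.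
have {}XC : X \subset C := subset_trans XC (subD1set C c).
have scC : [set c] \subset C by rewrite sub1set.
have sub P C' : C' \subset C -> sep P C -> sep P C' by move=> CC; exact: sepS.
have farS P C' : C' \subset C -> ~~ touch P C -> ~~ touch P C'.
  by move=> CC; apply: contra; exact: touchS.
have sAX : sep A X by apply: sub => //; atom.
have sBX : sep B X by apply: sub => //; atom.
have sDc : sep D [set c] by apply: sub => //; atom.
have sEX : sep E X by apply: sub => //; atom.
have sAc : sep A [set c] by apply: sub => //; atom.
have sBc : sep B [set c] by apply: sub => //; atom.
have sEc : sep E [set c] by apply: sub => //; atom.
have tAX : ~~ touch A X by apply: farS => //; atom.
have tEX : ~~ touch E X by apply: farS => //; rewrite touchC; atom.
have tAc : ~~ touch A [set c] by apply: farS => //; atom.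
have tEc : ~~ touch E [set c] by apply: farS => //; rewrite touchC; atom.
rewrite touchUr in tc.
by split=> //; [split=> //; exact: conn1 | atoms | atoms].
Qed.

(* Induction on |A| + |B|, with B = {b} and C = {c} by house_model_shrink. If b
   has two neighbours in A, these are separated by a splitting of A; either one
   part can replace A, or {b}, {c}, D and the two parts form a house. If b has a
   single neighbour x in A, split A into A1 containing x and A2: A2 moves to D or
   E, or else A1 joins the cycle in the place of B, which rotates to C. *)
Lemma house_model_normal A B C D E : house_model A B C D E ->
  exists a b c D' E', house_model [set a] [set b] [set c] D' E'.
Proof.
have [n] := ubnP (#|A| + #|B|); elim: n A B C D E => // n IH A B C D E ABn.
move=> /house_model_shrink[c [X [_ _]]]; move: (D :|: X) => {C X}D.
(* Shrinking [B] in the reflected house moves [X] into [A]; as [X] omits [b], the new [A] alone has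
   fewer than [n] vertices. *)
move=> /house_model_sym /house_model_shrink[b [X [bB XB /house_model_sym]]].
have : #|A :|: X| < n.
  have cAX : #|A :|: X| <= #|A| + #|X| := leq_card_setU A X.
  have := subset_leq_card XB; have := cardsD1 b B; rewrite bB; lia.
move: (A :|: X) => {B X ABn bB XB}A An m; move: (m) => [[cA cb] [cc cD] cE nears fars].
have shrink A' A2 : A = A' :|: A2 -> conn A' -> sep A' A2 -> touch A' A2 ->
    touch A' [set b] -> touch A' D -> touch A' E ->
    exists a b c D' E', house_model [set a] [set b] [set c] D' E'.
  move=> AE cA' s12 t12 tb tD tE; rewrite {}AE in An nears fars.
  apply: (IH A' [set b] [set c] D E).
    have A2_gt0 : 0 < #|A2| by case/touchP: t12 => x [y [_ yA2 _]]; apply/card_gt0P; exists y.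
    move: An; rewrite cardsU disjoint_setI0 // cards0 cards1; clear -A2_gt0; lia.
  by split=> //; atoms.
have [x [xA bx]] : exists x, x \in A /\ adj b x.
  have /touchP[x [y [xA /set1P-> xb]]] : touch A [set b] by unpack.
  by exists x; rewrite adj_sym.
have [A1|[a [aA ax]]] : A = [set x] \/ exists a, a \in A /\ a != x.
  case: (pickP [pred a | (a \in A) && (a != x)]) => [a /andP[]|no]; first by right; exists a.
  left; apply/setP => a; rewrite inE; have := no a; rewrite /=.
  by case: eqVneq => [->|_]; rewrite ?andbT ?xA.
  by rewrite A1 in m; exists x, b, c, D, E.
have An2 : 1 < #|A|.
  by rewrite (cardsD1 x) xA (cardsD1 a) !inE ax aA.
case: (pickP [pred a | [&& a \in A, a != x & adj b a]]) => [x' /and3P[x'A x'x bx']|unique].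
  have [|A1 [A2 [[cA1 cA2] [xA1 x'A2] AE s12 t12]]] := conn_split cA xA x'A.
    by rewrite eq_sym.
  have side A' A'' : A = A' :|: A'' -> conn A' -> conn A'' -> sep A' A'' ->
      touch A' A'' -> touch A' [set b] -> touch A'' [set b] -> touch A' D ->
      exists a b c D' E', house_model [set a] [set b] [set c] D' E'.
    move=> AE' c1 c2 s t tb1 tb2 tD.
    have AE2 : A = A'' :|: A' by rewrite setUC.
    have [tD2|ntD2] := boolP (touch A'' D).
      have : touch A E by unpack.
      rewrite AE' touchUl => /orP[tE|tE].
        exact: shrink AE' c1 s t tb1 tD tE.
      by apply: shrink AE2 c2 _ _ tb2 tD2 tE; atom.
    (* [A''] does not touch [D], so the square is [b], [c], [D], [A'] with roof [A'']. Its measure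
       is 2, below [n] because [A] has at least two vertices. *)
    apply: (IH [set b] [set c] D A' A''); first by rewrite !cards1; clear -An An2; lia.
    rewrite AE' in nears fars; by split=> //; atoms.
  have tb1 : touch A1 [set b] by apply: (@touch_mem _ _ _ x b); rewrite ?inE // adj_sym.
  have tb2 : touch A2 [set b] by apply: (@touch_mem _ _ _ x' b); rewrite ?inE // adj_sym.
  have : touch A D by unpack.
  rewrite AE touchUl => /orP[tD|tD]; first exact: side AE cA1 cA2 s12 t12 tb1 tb2 tD.
  by apply: side _ cA2 cA1 _ _ tb2 tb1 tD; rewrite 1?setUC //; atom.
have [|A1 [A2 [[cA1 cA2] [xA1 aA2] AE s12 t12]]] := conn_split cA xA aA; first by rewrite eq_sym.
have tb1 : touch A1 [set b] by apply: (@touch_mem _ _ _ x b); rewrite ?inE // adj_sym.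
have ntb2 : ~~ touch A2 [set b].
  apply/touchP => -[y [z [yA2 /set1P-> yb]]].
  have := unique y; rewrite /= AE inE yA2 orbT /= (adj_sym b) yb andbT.
  by case: eqVneq => // yx; rewrite yx (disjointFr s12 xA1) in yA2.
have cardA : #|A| = #|A1| + #|A2| by rewrite AE cardsU disjoint_setI0 // cards0 subn0.
have A1_gt0 : 0 < #|A1| by apply/card_gt0P; exists x.
have A2_gt0 : 0 < #|A2| by apply/card_gt0P; exists a.
have [tAD tAE] : touch A D /\ touch A E by unpack.
rewrite AE in nears fars; rewrite AE !touchUl in tAD tAE.
have [tD|ntD] := boolP (touch A1 D); have [tE|ntE] := boolP (touch A1 E);
  rewrite ?(negPf ntD) ?(negPf ntE) /= in tAD tAE.
- exact: shrink AE cA1 s12 t12 tb1 tD tE.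
- apply: (IH A1 [set b] [set c] D (E :|: A2)); first by rewrite cards1; clear -An cardA A2_gt0; lia.
  by split=> //; [apply: connU => //; atom | atoms | atoms].
- apply: (IH A1 [set b] [set c] (D :|: A2) E); first by rewrite cards1; clear -An cardA A2_gt0; lia.
  by split=> //; [split=> //; apply: connU => //; atom | atoms | atoms].
(* [A1] touches neither [D] nor [E], so it takes the place of [B], and [b] that of [C]. The measure
   becomes the size of the old [A]. *)
- apply: (IH A2 A1 [set b] (D :|: [set c]) E); first by clear -An cardA; lia.
  by split=> //; [split=> //; apply: connU => //; unpack; atom | atoms | atoms].
Qed.

(** * The criterion in terms of vertices *)

Definition nonneighbours (b : G) : {set G} := [set v | (v != b) && ~~ adj b v].

Definition house_witness (b c x p q y : G) : bool :=
  [&& adj b c, adj b x, c != x, ~~ adj c x, adj x p, adj x q, p != q, ~~ adj c p,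
      adj c y, p \in nonneighbours b, q \in component (nonneighbours b) p
    & y \in component (nonneighbours b) p].

Lemma subset_nonneighbours b A : (A \subset nonneighbours b) = far [set b] A.
Proof.
rewrite /far sep1; apply/idP/andP => [/subsetP sub|[bA nt]].
  split; first by apply/negP => /sub; rewrite inE eqxx.
  by apply/touchP => -[u [v [/set1P-> /sub]]]; rewrite inE => /andP[_ /negP].
apply/subsetP => v vA; rewrite inE; apply/andP; split.
  by apply: contraNneq bA => <-.
by apply: contra nt => bv; apply: touch_mem bv; rewrite ?inE.
Qed.

(** After normalisation [E :|: D] is connected and avoids the closed neighbourhood of [b], so it
    lies in one component; [p] is taken in [E], which is far from [c], and [q] and [y] in [D]. *)
Lemma house_witness_of_model A B C D E : house_model A B C D E ->
  exists b c x p q y, house_witness b c x p q y.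
Proof.
case/house_model_normal=> x [b [c [{}D [{}E [_ [_ cD] cE nears fars]]]]].
unpack.
have far_b : far [set b] (D :|: E) by atoms.
have cDE : conn (E :|: D) by apply: connU => //; rewrite touchC.
have [/touchP[? [p [/set1P-> pE xp]]] /touchP[? [q [/set1P-> qD xq]]]] :
  touch [set x] E /\ touch [set x] D by split.
have /touchP[? [y [/set1P-> yD cy]]] : touch [set c] D by [].
rewrite -subset_nonneighbours setUC in far_b.
have pDE : p \in E :|: D by rewrite inE pE.
have /subsetP sub := conn_component cDE far_b pDE.
have xb : adj x b by rewrite -touch1; atom.
have bc : adj b c by rewrite -touch1; atom.
have xc : ~~ adj x c by rewrite -touch1; atom.
have x_c : x != c.
  have : sep [set x] [set c] by atom.
  by rewrite sep1 inE.
have cp : ~~ adj c p.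
  have nt : ~~ touch [set c] E by atom.
  by apply: contra nt => cp; apply: touch_mem cp; rewrite ?inE.
have pq : p != q.
  have sDE : sep D E by atom.
  by apply: contraTneq pE => ->; rewrite (disjointFr sDE qD).
have qDE : q \in E :|: D by rewrite inE qD orbT.
have yDE : y \in E :|: D by rewrite inE yD orbT.
exists b, c, x, p, q, y; rewrite /house_witness bc (adj_sym b) xb eq_sym x_c (adj_sym c) xc.
by rewrite xp xq pq cp cy (subsetP far_b p pDE) !sub.
Qed.

Lemma house_model_of_witness b c x p q y : house_witness b c x p q y ->
  exists A B C D E, house_model A B C D E.
Proof.
case/and5P=> bc bx c_x cx /and5P[xp xq pq cp /and4P[cy pW qp yp]].
pose W := nonneighbours b; pose Z := [set v in W | ~~ adj c v]; pose K := component Z p.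
have pZ : p \in Z by rewrite inE pW.
have cK : conn K := component_conn pZ.
have /subsetP KZ : K \subset Z := component_sub pZ.
have ZW v : v \in Z -> v \in W by rewrite inE => /andP[].
have Wb v : v \in W -> v != b /\ ~~ adj b v by rewrite inE => /andP[].
have pK : p \in K := component_refl Z p.
have Wc v : v \in W -> v != c by move=> /Wb[_]; apply: contraNneq => ->.
have Wx v : v \in W -> v != x by move=> /Wb[_]; apply: contraNneq => ->.
have singletons (u v : G) : u != v -> sep [set u] [set v] by rewrite sep1 inE.
have nadj1 (u v : G) : ~~ adj u v -> ~~ touch [set u] [set v] by rewrite touch1.
have adj1 (u v : G) : adj u v -> touch [set u] [set v] by rewrite touch1.
have sepW u A : A \subset W -> (forall v, v \in W -> v != u) -> sep [set u] A.
  by move=> /subsetP AW ne; rewrite sep1; apply/negP => /AW/ne; rewrite eqxx.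
have tbW A : A \subset W -> ~~ touch [set b] A.
  by move=> /subsetP AW; apply/touchP => -[u [v [/set1P-> /AW/Wb[_ /negP]]]].
have KW : K \subset W by apply/subsetP => v /KZ/ZW.
have tcK : ~~ touch [set c] K.
  apply/touchP => -[u [v [/set1P-> /KZ]]]; rewrite inE => /andP[_ /negP] //.
have b_c : b != c by apply: contraTneq bc => ->; rewrite adj_irr.
have b_x : b != x by apply: contraTneq bx => ->; rewrite adj_irr.
have sW A : A \subset W -> [/\ sep [set b] A, sep [set c] A & sep [set x] A].
  move=> AW; split; apply: sepW => // v vW; first [by case: (Wb v vW) | exact: Wc | exact: Wx].
have [sbK scK sxK] := sW K KW.
have tbK := tbW K KW.
have txK : touch [set x] K by apply: touch_mem xp; rewrite ?inE.
(* Otherwise [K] is closed in [W], hence contains the whole component of [p] in [W] and so [y]; but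
   [K] has no neighbour of [c]. *)
have [y0 [y0W cy0 ty0K]] : exists y0, [/\ y0 \in W, adj c y0 & touch [set y0] K].
  case: (pickP [pred v | [&& v \in W, adj c v & touch [set v] K]]) => [v /and3P[]|no].
    by exists v.
  have /subsetP/(_ y yp) : component W p \subset K.
    apply: component_ind => // u v uK uW vW uv.
    apply: (component_closed uK (KZ u uK) _ uv); rewrite inE vW /=.
    apply: contraFN (no v) => cv; rewrite /= vW cv /= touchC.
    by apply: touch_mem uv; rewrite ?inE.
  by move/KZ; rewrite inE cy andbF.
have qW : q \in W := subsetP (component_sub pW) q qp.
have y0sub : [set y0] \subset W by rewrite sub1set.
have [sby scy sxy] := sW _ y0sub; have tby := tbW _ y0sub.
have y0K : y0 \notin K by apply/negP => /KZ; rewrite inE cy0 andbF.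
have syK : sep [set y0] K by rewrite sep1.
have tcy : touch [set c] [set y0] := adj1 _ _ cy0.
have [tbc tbx] := (adj1 _ _ bc, adj1 _ _ bx).
have [sbc sbx] := (singletons _ _ b_c, singletons _ _ b_x).
have [scx tcx] := (singletons _ _ c_x, nadj1 _ _ cx).
have [xy0|nxy0] := boolP (adj x y0).
  have txy := adj1 _ _ xy0.
  exists [set x], [set b], [set c], [set y0], K.
  by split; [split; exact: conn1 | split; exact: conn1 | exact: cK | atoms | atoms].
have txy := nadj1 _ _ nxy0.
have [qK|qK] := boolP (q \in K).
  (* The part touching [y0] joins it in the role of [D]; the other part is the roof. *)
  have split_model K1 K2 u v : conn K1 -> conn K2 -> u \in K1 -> v \in K2 ->
      K = K1 :|: K2 -> sep K1 K2 -> touch K1 K2 -> adj x u -> adj x v ->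
      touch [set y0] K1 -> exists A B C D E, house_model A B C D E.
    move=> c1 c2 uK1 vK2 KE s12 t12 xu xv ty1.
    have tx1 : touch [set x] K1 by apply: touch_mem xu; rewrite ?inE.
    have tx2 : touch [set x] K2 by apply: touch_mem xv; rewrite ?inE.
    exists [set x], [set b], [set c], ([set y0] :|: K1), K2.
    rewrite KE in sbK scK sxK tbK tcK syK.
    by split; [split; exact: conn1
      | split; [exact: conn1 | apply: connU => //; exact: conn1] | | atoms | atoms].
  have [K1 [K2 [[c1 c2] [pK1 qK2] KE s12 t12]]] := conn_split cK pK qK pq.
  have : touch [set y0] K1 || touch [set y0] K2 by rewrite -touchUr -KE.
  case/orP => ty; first exact: split_model c1 c2 pK1 qK2 KE s12 t12 xp xq ty.
  by apply: split_model c2 c1 qK2 pK1 _ _ _ xq xp ty; rewrite 1?setUC //; atom.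
pose P := (W :\: K) :\ y0; pose L := component P q.
have qP : q \in P.
  by rewrite !in_setD in_set1 qK qW !andbT; apply: contraNneq nxy0 => <-.
have /subsetP LP : L \subset P := component_sub qP.
have cL : conn L := component_conn qP.
have LW : L \subset W by apply/subsetP => v /LP; rewrite !in_setD => /and3P[].
have [sbL scL sxL] := sW L LW; have tbL := tbW L LW.
have sLK : sep L K.
  rewrite /sep disjoint_subset; apply/subsetP => v /LP.
  by rewrite !in_setD inE => /and3P[].
have syL : sep [set y0] L.
  by rewrite sep1; apply/negP => /LP; rewrite !in_setD in_set1 eqxx.
have txL : touch [set x] L by apply: touch_mem xq; rewrite ?inE //; exact: component_refl.
have [tyL|ntyL] := boolP (touch [set y0] L).
  exists [set x], [set b], [set c], ([set y0] :|: L), K.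
  by split; [split; exact: conn1
    | split; [exact: conn1 | apply: connU => //; exact: conn1] | | atoms | atoms].
have [tcL|ntcL] := boolP (touch [set c] L).
  (* Here [b] becomes the roof: it is adjacent to [c] and [x], but not to [y0] or any vertex of
     [K]. *)
  exists [set c], [set y0], K, ([set x] :|: L), [set b].
  by split; [split; exact: conn1
    | split; [ | apply: connU => //; exact: conn1] | exact: conn1 | atoms | atoms].
(* Otherwise L is the whole component of q in W, which contains p. *)
have sub : component W q \subset L.
  apply: component_ind; first exact: component_refl.
  move=> u v uL uW vW uv.
  have vy0 : v != y0.
    apply: contraNneq ntyL => <-; rewrite touchC.
    by apply: touch_mem uv; rewrite ?inE.
  (* A vertex [u] of [L] with a neighbour in [K] is not adjacent to [c], hence would lie in [K],
     which is disjoint from [L]. *)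
  have vK : v \notin K.
    apply/negP => vK; have uK : u \in K.
      apply: (component_closed vK (KZ v vK)); last by rewrite adj_sym.
      rewrite inE uW; apply: contra ntcL => cu.
      by apply: touch_mem cu; rewrite ?inE.
    by rewrite (disjointFr sLK uL) in uK.
  by apply: (component_closed uL (LP u uL) _ uv); rewrite !in_setD in_set1 vy0 vK.
have pL : p \in L by apply: (subsetP sub); rewrite component_sym.
by rewrite (disjointFr sLK pL) in pK.
Qed.

Lemma house_minorP : induced_minor house G <->
  exists b c x p q y, house_witness b c x p q y.
Proof.
split=> [/minor_map_of_induced_minor[f /house_model_of_minor_map]|].
  by move=> [A [B [C [D [E /house_witness_of_model]]]]].
move=> [b [c [x [p [q [y /house_model_of_witness[A [B [C [D [E m]]]]]]]]]]].
have [f mf] := minor_map_of_house_model m; exact: induced_minor_of_minor_map mf.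
Qed.

End House.

(** * Structured programs *)

Definition state := ((nat -> nat) * seq bool)%type.

Definition is_op (i : instr) : bool :=
  match i with Ijump _ _ | Ihalt _ => false | _ => true end.

Definition effect (s : state) (i : instr) : state :=
  let: (r, w) := s in
  match i with
  | Iconst i c => (upd r i c, w)
  | Iadd i j k => (upd r i (r j + r k), w)
  | Isub i j k => (upd r i (r j - r k), w)
  | Iload i j => (upd r i (r (r j)), w)
  | Istore i j => (upd r (r i) (r j), w)
  | Iread i => (upd r i (head false w), behead w)
  | Ijump _ _ | Ihalt _ => s
  end.

(* [Unless i c] runs [c] if register i is 0; [Do c i] runs [c] and repeats it
   as long as register i is positive afterwards. These two forms compile to a
   single conditional jump each, without a scratch register. *)
Inductive cmd :=
| Ops of seq instr
| Seq of cmd & cmd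
| Unless of nat & cmd
| Do of cmd & nat.

(** [a] is the address of the first instruction, on which the code depends because jump targets are
    absolute. *)
Fixpoint compile (a : nat) (c : cmd) : program :=
  match c with
  | Ops l => l
  | Seq c1 c2 => compile a c1 ++ compile (a + size (compile a c1)) c2
  | Unless i c => Ijump (a.+1 + size (compile a.+1 c)) i :: compile a.+1 c
  | Do c i => rcons (compile a c) (Ijump a i)
  end.

Inductive exec : cmd -> state -> nat -> state -> Prop :=
| Exec_ops l s : all is_op l -> exec (Ops l) s (size l) (foldl effect s l)
| Exec_seq c1 c2 s1 s2 s3 t1 t2 :
    exec c1 s1 t1 s2 -> exec c2 s2 t2 s3 -> exec (Seq c1 c2) s1 (t1 + t2) s3
| Exec_skip i c s : 0 < s.1 i -> exec (Unless i c) s 1 s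
| Exec_unless i c s t s' :
    s.1 i = 0 -> exec c s t s' -> exec (Unless i c) s t.+1 s'
| Exec_exit c i s t s' : exec c s t s' -> s'.1 i = 0 -> exec (Do c i) s t.+1 s'
| Exec_repeat c i s1 s2 s3 t1 t2 :
    exec c s1 t1 s2 -> 0 < s2.1 i -> exec (Do c i) s2 t2 s3 ->
    exec (Do c i) s1 (t1.+1 + t2) s3.

(** The surrounding code [pre], [suf] and the remaining time [t'] are arbitrary, so that the
    induction composes blocks. *)
Lemma run_compile c s t s' : exec c s t s' -> forall pre suf t',
  run (pre ++ compile (size pre) c ++ suf) (t + t')
      (Config (size pre) s.1 s.2) =
  run (pre ++ compile (size pre) c ++ suf) t'
      (Config (size pre + size (compile (size pre) c)) s'.1 s'.2).
Proof.
have nthE pre i suf : nth (Ihalt false) (pre ++ i :: suf) (size pre) = i.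
  by rewrite nth_cat ltnn subnn.
elim=> {c s t s'}.
- move=> l s; elim: l s => [|i l IH] s /=; first by move=> _ pre suf t'; rewrite addn0.
  case/andP=> opi opl pre suf t'.
  have /= := IH (effect s i) opl (rcons pre i) suf t'.
  rewrite cat_rcons size_rcons addSnnS => <-.
  by case: i opi => //= *; rewrite nthE; case: s.
- move=> c1 c2 s1 s2 s3 t1 t2 _ IH1 _ IH2 pre suf t' /=.
  rewrite -addnA -catA IH1 catA.
  have := IH2 (pre ++ compile (size pre) c1) suf t'.
  by rewrite !size_cat addnA => ->; rewrite -!catA.
- by move=> i c s ri pre suf t' /=; rewrite nthE /= ri addSnnS.
- move=> i c s t s' ri _ IH pre suf t' /=; rewrite nthE /= ri ltnn.
  set j := Ijump _ _.
  have := IH (rcons pre j) suf t'.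
  by rewrite cat_rcons !size_rcons addSnnS.
- move=> c i s t s' _ IH ri pre suf t'.
  rewrite [compile _ _]/= cat_rcons addSnnS IH.
  have := nthE (pre ++ compile (size pre) c) (Ijump (size pre) i) suf.
  by rewrite size_cat -catA /= => ->; rewrite ri size_rcons addnS.
- move=> c i s1 s2 s3 t1 t2 _ IH1 ri _ IH2 pre suf t'.
  rewrite -IH2 -!addnA [compile _ _]/= cat_rcons addSnnS IH1.
  have := nthE (pre ++ compile (size pre) c) (Ijump (size pre) i) suf.
  by rewrite size_cat -catA /= => ->; rewrite ri.
Qed.

(** A Hoare triple for total correctness, with a time bound. *)
Definition runs (c : cmd) (s : state) (T : nat) (Q : state -> Prop) : Prop :=
  exists s' t, [/\ exec c s t s', t <= T & Q s'].

Lemma runs_weaken c s T T' (Q Q' : state -> Prop) :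
  runs c s T Q -> T <= T' -> (forall s', Q s' -> Q' s') -> runs c s T' Q'.
Proof.
move=> [s' [t [ex tT Qs]]] TT' QQ; exists s', t; split=> //.
  exact: leq_trans tT TT'.
exact: QQ.
Qed.

Lemma runs_ops l s T (Q : state -> Prop) :
  all is_op l -> size l <= T -> Q (foldl effect s l) -> runs (Ops l) s T Q.
Proof. by move=> opl lT Qs; exists (foldl effect s l), (size l); split=> //; constructor. Qed.

Lemma runs_seq c1 c2 s T1 T (Q : state -> Prop) :
  T1 <= T -> runs c1 s T1 (fun s' => runs c2 s' (T - T1) Q) -> runs (Seq c1 c2) s T Q.
Proof.
move=> TT [s2 [t1 [ex1 t1T [s3 [t2 [ex2 t2T Qs]]]]]].
exists s3, (t1 + t2); split=> //; last by lia.
exact: Exec_seq ex1 ex2.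
Qed.

Lemma runs_unless i c s T (Q : state -> Prop) :
  (0 < s.1 i -> Q s) -> (s.1 i = 0 -> runs c s T Q) -> runs (Unless i c) s T.+1 Q.
Proof.
case: (posnP (s.1 i)) => [ri _ /(_ ri) [s' [t [ex tT Qs]]]|ri /(_ isT) Qs _].
  by exists s', t.+1; split=> //; constructor.
by exists s, 1; split=> //; constructor.
Qed.

(** [Inv k] holds after [k] rounds, and the tested register is positive exactly while rounds remain.
    The body precedes the test, hence [0 < n]; the extra step per round is the jump. *)
Lemma runs_do c i (Inv : nat -> state -> Prop) T n s :
  0 < n -> Inv 0 s ->
  (forall k s, k < n -> Inv k s ->
     runs c s T (fun s' => Inv k.+1 s' /\ (0 < s'.1 i) = (k.+1 < n))) ->
  runs (Do c i) s (n * T.+1) (Inv n).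
Proof.
move=> n_gt0 Inv0 step.
suff loop m k s' : k + m.+1 = n -> Inv k s' -> runs (Do c i) s' (m.+1 * T.+1) (Inv n).
  by case: n n_gt0 step loop => // n _ step loop; apply: loop Inv0.
elim: m k s' => [|m IH] k s' kn Invk.
  have [|s2 [t [ex tT [Inv2 pos]]]] := step k s' _ Invk; first by lia.
  exists s2, t.+1; split; first by apply: Exec_exit ex _; lia.
    by lia.
  by have <- : k.+1 = n by lia.
have [|s2 [t [ex tT [Inv2 pos]]]] := step k s' _ Invk; first by lia.
have [|s3 [t3 [ex3 t3T Inv3]]] := IH k.+1 s2 _ Inv2; first by lia.
exists s3, (t.+1 + t3); split=> //; last by rewrite mulSn; lia.
by apply: Exec_repeat ex _ ex3; lia.
Qed.

(* Register conventions: the constant 1, the number n of vertices, the first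
   free memory address, the truth value of the last formula evaluated, and two
   scratch registers. *)
Notation rONE := 0.
Notation rN := 1.
Notation rFREE := 2.
Notation rRES := 3.
Notation rT := 4.
Notation rU := 5.
(* Variable l of a formula occupies four registers: its value v, the offset
   v * n of its row in the adjacency matrix, and a loop counter with the
   corresponding offset. *)
Notation rval l := (6 + 4 * l).
Notation rrow l := (7 + 4 * l).
Notation rcnt l := (8 + 4 * l).
Notation roff l := (9 + 4 * l).

Ltac upds := rewrite /upd; repeat match goal with
  |- context [?a == ?b] =>
    first [ rewrite (_ : (a == b) = true); [|by apply/eqP; lia]
          | rewrite (_ : (a == b) = false); [|by apply/eqP; lia]] end.

(** [v] counts from 0 and [w] follows it as [v * n], obtained by additions alone. Since [Do] runs
    its body at least once, the test of [1 - n] skips the loop when [n = 0]. *)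
Definition For (v w : nat) (body : cmd) : cmd :=
  Seq (Ops [:: Iconst v 0; Iconst w 0; Isub rT rONE rN])
      (Unless rT (Do (Seq body
        (Ops [:: Iadd v v rONE; Iadd w w rN; Isub rT rN v])) rT)).

(** The invariant must ignore the registers that the loop control changes. The bound counts three
    operations and a test at the start, and three operations and a jump in each round. *)
Lemma runs_for v w body (Inv : nat -> state -> Prop) n T s :
  5 < v -> 5 < w -> v != w ->
  s.1 rN = n -> s.1 rONE = 1 -> Inv 0 s ->
  (forall k s r', Inv k s ->
     (forall a : nat, a != v -> a != w -> a != rT -> r' a = s.1 a) -> Inv k (r', s.2)) ->
  (forall k s, k < n -> Inv k s -> s.1 rN = n -> s.1 rONE = 1 ->
     s.1 v = k -> s.1 w = k * n ->
     runs body s T (fun s' => [/\ Inv k.+1 s', s'.1 rN = n, s'.1 rONE = 1,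
                                 s'.1 v = k & s'.1 w = k * n])) ->
  runs (For v w body) s (4 + n * (T + 4)) (Inv n).
Proof.
move=> v5 w5 vw sN sONE Inv0 stable step.
apply: (@runs_seq _ _ _ 3); first by lia.
apply: runs_ops => //=; case: s sN sONE Inv0 => r w0 /= sN sONE Inv0.
set r1 := upd _ _ _.
have r1E (a : nat) : a != v -> a != w -> a != rT -> r1 a = r a.
  by move=> *; rewrite /r1; upds.
have Inv1 : Inv 0 (r1, w0) by apply: (stable 0 (r, w0)).
have -> : 4 + n * (T + 4) - 3 = (n * (T + 4)).+1 by lia.
have r1T : r1 rT = 1 - n by rewrite /r1; upds; rewrite sN sONE.
apply: runs_unless => /= [|r1T0].
  by rewrite r1T => n0; have -> : n = 0 by lia.
have n_gt0 : 0 < n by lia.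
apply: runs_weaken (_ : runs _ _ (n * (T + 3).+1) (fun s' => [/\ Inv n s',
  s'.1 rN = n, s'.1 rONE = 1, s'.1 v = n & s'.1 w = n * n])) _ _.
- apply: (runs_do (Inv := fun k s' => [/\ Inv k s', s'.1 rN = n, s'.1 rONE = 1,
           s'.1 v = k & s'.1 w = k * n])) => //.
    by split=> //=; rewrite /r1; upds.
  move=> k s kn [Invk kN kONE kv kw].
  apply: (@runs_seq _ _ _ T); first by lia.
  apply: runs_weaken (step k s kn Invk kN kONE kv kw) _ _ => //.
  move=> [r2 w2] /= [Inv2 N2 ONE2 v2 w2E].
  apply: runs_ops => //=; first by lia.
  split; [split|]; rewrite /=.
  + by apply: (stable k.+1 (r2, w2)) => //= a *; upds.
  + by upds.
  + by upds.
  + by upds; lia.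
  + by upds; lia.
  + by upds; lia.
- by rewrite -addnS.
- by move=> s' [].
Qed.

(** * Evaluating formulas *)

(* First-order formulas with reachability. Variables are de Bruijn levels: a
   formula at depth d has the free variables 0, ..., d - 1, and its outermost
   quantifier binds d. In [Reach f i j] the edge relation f has the two further
   variables d (source) and d + 1 (target). *)
Inductive form :=
| Adj of nat & nat
| Eq of nat & nat
| Not of form
| And of form & form
| Ex of form
| Reach of form & nat & nat.

Definition setv (V : Type) (e : nat -> V) (l : nat) (v : V) : nat -> V :=
  fun i => if i == l then v else e i.

Fixpoint eval (V : finType) (g : rel V) (d : nat) (e : nat -> V) (f : form) : bool :=
  match f with
  | Adj i j => g (e i) (e j)
  | Eq i j => e i == e j
  | Not f => ~~ eval g d e f
  | And f1 f2 => eval g d e f1 && eval g d e f2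
  | Ex f => [exists v, eval g d.+1 (setv e d v) f]
  | Reach f i j =>
      connect (fun u v => eval g d.+2 (setv (setv e d u) d.+1 v) f) (e i) (e j)
  end.

Fixpoint well_scoped (d : nat) (f : form) : bool :=
  match f with
  | Adj i j | Eq i j => (i < d) && (j < d)
  | Not f => well_scoped d f
  | And f1 f2 => well_scoped d f1 && well_scoped d f2
  | Ex f => well_scoped d.+1 f
  | Reach f i j => [&& i < d, j < d & well_scoped d.+2 f]
  end.

(** The number of variables in use at once beyond the free ones, which fixes how many registers the
    program needs. *)
Fixpoint depth (f : form) : nat :=
  match f with
  | Adj _ _ | Eq _ _ => 0
  | Not f => depth f
  | And f1 f2 => maxn (depth f1) (depth f2)
  | Ex f => (depth f).+1
  | Reach f _ _ => (depth f).+2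
  end.

(* Reachability marks, in an array of n cells allocated at the free pointer,
   the vertices reached so far, and saturates the marks in n rounds. *)
Fixpoint code (M d : nat) (f : form) : cmd :=
  match f with
  | Adj i j => Ops [:: Iadd rT (rrow i) (rval j); Iconst rU M; Iadd rT rT rU;
                       Iload rRES rT]
  | Eq i j => Ops [:: Isub rT (rval i) (rval j); Isub rU (rval j) (rval i);
                      Iadd rT rT rU; Isub rRES rONE rT]
  | Not f => Seq (code M d f) (Ops [:: Isub rRES rONE rRES])
  | And f1 f2 =>
      Seq (code M d f1)
          (Seq (Ops [:: Isub rT rONE rRES]) (Unless rT (code M d f2)))
  | Ex f =>
      Seq (Ops [:: Iconst rRES 0])
          (For (rval d) (rrow d) (Unless rRES (code M d.+1 f)))
  | Reach f i j =>
      (* The array occupies the [n] cells just below the advanced free pointer, so cells are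
         addressed from [rFREE - n]. *)
      let mark k := [:: Isub rT rFREE rN; Iadd rT rT (rval k)] in
      Seq (Ops [:: Iadd rFREE rFREE rN])
     (Seq (For (rval d) (rrow d) (Ops (mark d ++ [:: Iconst rU 0; Istore rT rU])))
     (Seq (Ops (mark i ++ [:: Istore rT rONE]))
     (Seq (For (rcnt d) (roff d) (For (rval d) (rrow d)
            (Seq (Ops (mark d ++ [:: Iload rT rT; Isub rT rONE rT]))
                 (Unless rT (For (rval d.+1) (rrow d.+1)
                   (Seq (code M d.+2 f)
                   (Seq (Ops [:: Isub rT rONE rRES])
                        (Unless rT (Ops (mark d.+1 ++ [:: Istore rT rONE]))))))))))
          (Ops (mark j ++ [:: Iload rRES rT; Isub rFREE rFREE rN])))))
  end.

Fixpoint cost (n : nat) (f : form) : nat :=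
  match f with
  | Adj _ _ | Eq _ _ => 4
  | Not f => cost n f + 1
  | And f1 f2 => cost n f1 + cost n f2 + 2
  | Ex f => 5 + n * (cost n f + 5)
  | Reach f _ _ =>
      1 + ((4 + n * 8) + (3 + ((4 + n * ((4 + n * ((5 + (4 + n * (cost n f + 9))) + 4)) + 4)) + 4)))
  end.

Section Code.
Variables (V : finType) (g : rel V) (n M : nat).
Hypothesis cardV : #|V| = n.

Definition rank (v : V) : nat := enum_rank v.

Lemma rank_lt v : rank v < n. Proof. by rewrite -cardV ltn_ord. Qed.

Lemma rank_inj : injective rank.
Proof. by move=> u v /val_inj /enum_rank_inj. Qed.

Lemma rank_onto k : k < n -> exists v, rank v = k.
Proof. by rewrite -cardV => kn; exists (enum_val (Ordinal kn)); rewrite /rank enum_valK. Qed.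

Definition ready (d : nat) (e : nat -> V) (r : nat -> nat) : Prop :=
  [/\ r rONE = 1, r rN = n, M + n * n <= r rFREE,
      forall l, l < d -> r (rval l) = rank (e l) /\ r (rrow l) = rank (e l) * n
    & forall u v, r (M + (rank u * n + rank v)) = g u v].

(* The addresses preserved by formulas at depth d when the free pointer is F. *)
Definition safe (d F a : nat) : bool :=
  [|| a <= rFREE, 6 <= a < 6 + 4 * d | M <= a < F].

Definition agree (d F : nat) (r r' : nat -> nat) : Prop :=
  forall a, safe d F a -> r' a = r a.

Lemma agree_trans d F r1 r2 r3 : agree d F r1 r2 -> agree d F r2 r3 -> agree d F r1 r3.
Proof. by move=> h12 h23 a sa; rewrite h23 // h12. Qed.

Lemma agreeW d d' F F' r r' : d' <= d -> F' <= F -> agree d F r r' -> agree d' F' r r'.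
Proof. by move=> dd FF h a sa; apply: h; move: sa; rewrite /safe; lia. Qed.

(** Every cell that [ready] mentions is safe: the reserved registers, those of the first [d]
    variables, and the matrix, which ends by [F]. *)
Lemma ready_agree d e F r r' : 6 + 4 * d <= M -> M + n * n <= F ->
  ready d e r -> agree d F r r' -> ready d e r'.
Proof.
move=> dM MF [r1 rn rF rv rg] ag; split.
- by rewrite ag.
- by rewrite ag.
- by rewrite ag.
- move=> l ld; rewrite !ag; [exact: rv | |]; rewrite /safe; lia.
- move=> u v; rewrite ag //.
  have := rank_lt u; have := rank_lt v; rewrite /safe => hv hu.
  have : (rank u).+1 * n <= n * n by rewrite leq_mul2r hu orbT.
  by rewrite mulSn; lia.
Qed.

Lemma ready_setv d e r v : ready d e r -> r (rval d) = rank v ->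
  r (rrow d) = rank v * n -> ready d.+1 (setv e d v) r.
Proof.
move=> [r1 rn rF rv rg] hv hr; split=> // l ld.
rewrite /setv; case: eqP => [->//|/eqP ne]; apply: rv; lia.
Qed.

(** Evaluation must also preserve the memory from [M] up to the free pointer, where enclosing
    formulas keep their marks. The bound on [M] places all variable registers below the matrix. *)
Definition correct (d : nat) (f : form) : Prop :=
  well_scoped d f -> 6 + 4 * (d + depth f) <= M ->
  forall e r w, ready d e r ->
    runs (code M d f) (r, w) (cost n f)
      (fun s' => agree d (r rFREE) r s'.1 /\ s'.1 rRES = eval g d e f).

Lemma correct_Adj d i j : correct d (Adj i j).
Proof.
rewrite /correct /= => /andP[id jd] dM e r w [r1 rn rF rv rg].
have [vi wi] := rv i id; have [vj wj] := rv j jd.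
apply: runs_ops => //=; split.
  by move=> a; rewrite /safe => sa; upds.
by upds; rewrite wi vj -rg addnC.
Qed.

Lemma correct_Eq d i j : correct d (Eq i j).
Proof.
rewrite /correct /= => /andP[id jd] dM e r w [r1 rn rF rv rg].
have [vi wi] := rv i id; have [vj wj] := rv j jd.
apply: runs_ops => //=; split.
  by move=> a; rewrite /safe => sa; upds.
upds; rewrite vi vj r1; case: eqP => [->|ne]; first by rewrite subnn.
have : rank (e i) <> rank (e j) by move/rank_inj.
rewrite /=; lia.
Qed.

Lemma correct_Not d f : correct d f -> correct d (Not f).
Proof.
rewrite /correct /= => cf sc dM e r w rdy.
apply: (@runs_seq _ _ _ (cost n f)); first by lia.
apply: runs_weaken (cf sc dM e r w rdy) _ _ => // -[r' w'] /= [ag res].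
apply: runs_ops => //=; first by lia.
have r'1 : r' rONE = 1 by rewrite ag //; case: rdy.
split; last by upds; rewrite res r'1; case: eval.
by move=> a sa; rewrite -ag //; move: sa; rewrite /safe => sa; upds.
Qed.

Lemma correct_And d f1 f2 : correct d f1 -> correct d f2 -> correct d (And f1 f2).
Proof.
rewrite /correct /= => c1 c2 /andP[sc1 sc2] dM e r w rdy.
apply: (@runs_seq _ _ _ (cost n f1)); first by lia.
apply: runs_weaken (c1 sc1 _ e r w rdy) _ _ => //; first by lia.
move=> [r' w'] /= [ag res].
apply: (@runs_seq _ _ _ 1); first by lia.
have r'1 : r' rONE = 1 by rewrite ag //; case: rdy.
apply: runs_ops => //=.
set r2 := upd _ _ _.
have r2T : r2 rT = 1 - eval g d e f1 by rewrite /r2; upds; rewrite r'1 res.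
have ag2 : agree d (r rFREE) r r2.
  by move=> a sa; rewrite -ag //; move: sa; rewrite /safe /r2 => sa; upds.
have -> : cost n f1 + cost n f2 + 2 - cost n f1 - 1 = (cost n f2).+1 by lia.
apply: runs_unless => /= [|].
  rewrite r2T; case E: eval => //= _; split=> //.
  by rewrite /r2; upds; rewrite res E.
rewrite r2T; case E: eval => //= _.
have rdy2 : ready d e r2 by apply: (ready_agree _ _ rdy ag2); [lia | case: rdy].
apply: runs_weaken (c2 sc2 _ e r2 w' rdy2) _ _ => //; first by lia.
move=> [r3 w3] /= [ag3 ->]; split=> //.
by rewrite (ag2 rFREE) // in ag3; apply: agree_trans ag2 ag3.
Qed.

Lemma correct_Ex d f : correct d.+1 f -> correct d (Ex f).
Proof.
rewrite /correct /= => cf sc dM e r w rdy.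
apply: (@runs_seq _ _ _ 1); first by lia.
apply: runs_ops => //=.
pose res_upto k := [exists v : V, (rank v < k) && eval g d.+1 (setv e d v) f].
pose Inv k (s : state) := agree d (r rFREE) r s.1 /\ s.1 rRES = res_upto k.
have [r1 rn _ _ _] := rdy.
have /= run_loop := @runs_for (rval d) (rrow d) (Unless rRES (code M d.+1 f)) Inv n
  (cost n f).+1 (upd r rRES 0, w).
apply: runs_weaken (run_loop _ _ _ _ _ _ _ _) _ _ => //; clear run_loop.
- by lia.
- split=> /=; first by move=> a; rewrite /safe => sa; upds.
  by upds; rewrite /res_upto; case: existsP => // -[].
- move=> k s r' [ag res] h; split=> /=.
    by move=> a sa; rewrite -ag // h //; move: sa; rewrite /safe; lia.
  by rewrite h //; lia.
- move=> k [r2 w2] /= kn [/= ag res] r2n r21 r2v r2w.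
  have [v vk] := rank_onto kn.
  have stepE : res_upto k.+1 = res_upto k || eval g d.+1 (setv e d v) f.
    apply/existsP/orP => [[u /andP[uk eu]]|[/existsP[u /andP[uk eu]]|ev]].
    - case: (ltnP (rank u) k) => uk'; [left|right].
        by apply/existsP; exists u; rewrite uk'.
      by rewrite (_ : v = u) //; apply: rank_inj; lia.
    - by exists u; rewrite eu andbT; lia.
    - by exists v; rewrite ev andbT; lia.
  apply: runs_unless => /= [r2res|r2res].
    split=> //; split=> //=; rewrite stepE.
    by move: r2res; rewrite res; case: (res_upto k).
  have rdy2 : ready d.+1 (setv e d v) r2.
    apply: ready_setv; rewrite ?vk //.
    by apply: (ready_agree _ _ rdy ag); [lia | case: rdy].
  apply: runs_weaken (cf sc _ _ r2 w2 rdy2) _ _ => //; first by lia.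
  move=> [r3 w3] /= [ag3 res3]; split; rewrite ?ag3 //; try by rewrite /safe; lia.
  split=> /=; last first.
    by rewrite res3 stepE; move: r2res; rewrite res; case: (res_upto k).
  apply: (agree_trans ag); rewrite -(ag rFREE) //.
  by apply: agreeW ag3.
- by rewrite addSnnS; lia.
- move=> [r2 w2] [/= ag res]; split=> //; move: res => /= ->; congr nat_of_bool.
  by apply: eq_existsb => v; rewrite rank_lt.
Qed.

(** * Reachability by saturating marks *)

Definition marks (F : nat) (S : {set V}) (r : nat -> nat) : Prop :=
  forall u, r (F + rank u) = (u \in S).

Lemma marks_add F S r r' v :
  marks F S r -> r' (F + rank v) = 1 ->
  (forall u, u != v -> r' (F + rank u) = r (F + rank u)) -> marks F (v |: S) r'.
Proof.
move=> mS r'v r'u u; rewrite !inE; case: eqP => [->|/eqP ne]; first by rewrite r'v.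
by rewrite r'u.
Qed.

Section Reach.
Variables (d : nat) (f : form) (e : nat -> V) (r0 : nat -> nat) (F : nat) (p : V).
Hypotheses (cf : correct d.+2 f) (scf : well_scoped d.+2 f)
  (dM : 6 + 4 * (d.+2 + depth f) <= M) (rdy0 : ready d e r0)
  (MF : M + n * n <= F) (r0F : r0 rFREE = F + n).
Local Notation R :=
  (fun u v => eval g d.+2 (setv (setv e d u) d.+1 v) f).

(** The invariant keeps the marks sound, that is, confined to vertices reachable from [p], and
    complete for the targets tried so far. Variable [d] holds [u] throughout, hence [agree] at depth
    [d.+1]. *)
Lemma runs_scan u (S : {set V}) (s : state) : u \in S -> (forall v, v \in S -> connect R p v) ->
  agree d F r0 s.1 -> s.1 (rval d) = rank u -> s.1 (rrow d) = rank u * n ->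
  marks F S s.1 ->
  runs (For (rval d.+1) (rrow d.+1)
     (Seq (code M d.+2 f)
     (Seq (Ops [:: Isub rT rONE rRES])
       (Unless rT (Ops [:: Isub rT rFREE rN; Iadd rT rT (rval d.+1); Istore rT rONE])))))
   s (4 + n * (cost n f + 9))
   (fun s' => agree d.+1 F s.1 s'.1 /\
      exists S' : {set V}, [/\ marks F S' s'.1, {subset S <= S'},
        forall v, v \in S' -> connect R p v & forall v, R u v -> v \in S']).
Proof.
move=> uS Sp ags su sw mS.
pose Inv m (s' : state) := agree d.+1 F s.1 s'.1 /\
  exists S' : {set V}, [/\ marks F S' s'.1, {subset S <= S'},
    forall v, v \in S' -> connect R p v & forall v, rank v < m -> R u v -> v \in S'].
have [r01 r0n _ _ _] := rdy0.
rewrite (_ : cost n f + 9 = cost n f + 5 + 4); last by lia.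
have loop := @runs_for (rval d.+1) (rrow d.+1) _ Inv n (cost n f + 5) s.
apply: runs_weaken (loop _ _ _ _ _ _ _ _ _) _ _ => //; clear loop; try lia.
- by rewrite ags.
- by rewrite ags.
- by split; [move=> a | exists S; split].
- move=> k s1 r' [ag [S1 [mS1 SS1 S1p RS1]]] h; split.
    by move=> a sa /=; rewrite -ag // h //; move: sa; rewrite /safe; lia.
  by exists S1; split=> // v; rewrite /= h //; lia.
- move=> k [s1 w1] kn [/= ag [S1 [mS1 SS1 S1p RS1]]] s1n s11 s1v s1w.
  have [v vk] := rank_onto kn.
  have ag0 : agree d F r0 s1 by apply: (agree_trans ags); apply: agreeW ag.
  have rdy1 : ready d e s1 by apply: (ready_agree _ MF rdy0 ag0); lia.
  have rdy2 : ready d.+2 (setv (setv e d u) d.+1 v) s1.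
    apply: ready_setv; rewrite ?vk //.
    by apply: ready_setv; rewrite // ag // /safe; lia.
  apply: (@runs_seq _ _ _ (cost n f)); first by lia.
  apply: runs_weaken (cf scf _ w1 rdy2) _ _ => //.
  move=> [s2 w2] /= [ag2 res].
  (* The free pointer is [F + n] here, so evaluating [f] leaves the array of marks intact. *)
  rewrite (ag0 rFREE) // r0F in ag2.
  have Fs2 x : x < n -> s2 (F + x) = s1 (F + x).
    by move=> xn; apply: ag2; rewrite /safe; lia.
  have s2F : s2 rFREE = F + n by rewrite ag2 // ag0.
  have s21 : s2 rONE = 1 by rewrite ag2.
  have s2n : s2 rN = n by rewrite ag2.
  have s2v : s2 (rval d.+1) = k by rewrite ag2 // /safe; lia.
  have s2w : s2 (rrow d.+1) = k * n by rewrite ag2 // /safe; lia.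
  have ag3 : agree d.+1 F s.1 s2.
    by apply: (agree_trans ag); apply: agreeW ag2; lia.
  apply: (@runs_seq _ _ _ 1); first by lia.
  apply: runs_ops => //=.
  have -> : cost n f + 5 - cost n f - 1 = 4 by lia.
  apply: runs_unless => /=.
    rewrite {1}/upd /= s21 res => resT.
    split; try by upds.
    split=> /=; first by move=> a sa; rewrite -ag3 //; move: sa; rewrite /safe => sa; upds.
    exists S1; split=> //; first by move=> x; have xn := rank_lt x; upds; rewrite Fs2.
    move=> x; rewrite ltnS leq_eqVlt => /orP[/eqP xk|]; last exact: RS1.
    have -> : x = v by apply: rank_inj; lia.
    by move: resT; case: eval.
  rewrite {1}/upd /= s21 res => resT.
  have Ruv : R u v by move: resT; case: eval.
  apply: runs_ops => //=.
  set s3 := upd _ _ _.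
  have s3E a : a != rT -> a != F + k -> s3 a = s2 a.
    by move=> aT aF; rewrite /s3; move: aF; rewrite -s2v => aF; upds.
  have s3k : s3 (F + k) = 1 by rewrite /s3; upds.
  have ag4 : agree d.+1 F s.1 s3.
    move=> a sa; rewrite s3E ?ag3 //; move: sa; rewrite /safe; lia.
  split; rewrite ?s3E //; try lia.
  split=> //; exists (v |: S1); split.
  - apply: (marks_add mS1) => [|x ne]; first by rewrite /= vk.
    have := rank_lt x; have /eqP : rank x != rank v by rewrite (inj_eq rank_inj).
    by move=> ? ?; rewrite /= s3E ?Fs2 //; lia.
  - by move=> x xS; rewrite !inE SS1 ?orbT.
  - move=> x; rewrite !inE => /orP[/eqP ->|]; last exact: S1p.
    by apply: connect_trans (Sp u uS) _; apply: connect1.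
  - move=> x; rewrite ltnS leq_eqVlt !inE => /orP[/eqP xk|xk Rx]; last by rewrite RS1 ?orbT.
    by rewrite (_ : x = v) ?eqxx //; apply: rank_inj; lia.
- move=> s1 [ag [S1 [mS1 SS1 S1p RS1]]]; split=> //; exists S1; split=> // v.
  by apply: RS1; apply: rank_lt.
Qed.

(** Vertices marked during the round may be expanded too; only successors of those marked at its
    start are guaranteed. The registers of the outer loop are not covered by [agree d], so their
    preservation is stated separately. *)
Lemma runs_round (S : {set V}) (s : state) : (forall v, v \in S -> connect R p v) ->
  agree d F r0 s.1 -> marks F S s.1 ->
  runs (For (rval d) (rrow d)
     (Seq (Ops [:: Isub rT rFREE rN; Iadd rT rT (rval d); Iload rT rT; Isub rT rONE rT])
          (Unless rT (For (rval d.+1) (rrow d.+1)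
     (Seq (code M d.+2 f)
     (Seq (Ops [:: Isub rT rONE rRES])
       (Unless rT (Ops [:: Isub rT rFREE rN; Iadd rT rT (rval d.+1); Istore rT rONE]))))))))
   s (4 + n * ((5 + (4 + n * (cost n f + 9))) + 4))
   (fun s' => [/\ agree d F r0 s'.1, s'.1 (rcnt d) = s.1 (rcnt d),
      s'.1 (roff d) = s.1 (roff d) &
      exists S' : {set V}, [/\ marks F S' s'.1, {subset S <= S'},
        forall v, v \in S' -> connect R p v
      & forall u v, u \in S -> R u v -> v \in S']]).
Proof.
move=> Sp ags mS.
pose Inv m (s' : state) := [/\ agree d F r0 s'.1, s'.1 (rcnt d) = s.1 (rcnt d),
  s'.1 (roff d) = s.1 (roff d) &
  exists S' : {set V}, [/\ marks F S' s'.1, {subset S <= S'},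
    forall v, v \in S' -> connect R p v
  & forall u v, rank u < m -> u \in S -> R u v -> v \in S']].
have [r01 r0n _ _ _] := rdy0.
have loop := @runs_for (rval d) (rrow d) _ Inv n (5 + (4 + n * (cost n f + 9))) s.
apply: runs_weaken (loop _ _ _ _ _ _ _ _ _) _ _ => //; clear loop; try lia.
- by rewrite ags.
- by rewrite ags.
- by split=> //; exists S; split.
- move=> k s1 r' [ag cnt off [S1 [mS1 SS1 S1p RS1]]] h; split=> /=.
  + by move=> a sa; rewrite -ag // h //; move: sa; rewrite /safe; lia.
  + by rewrite h //; lia.
  + by rewrite h //; lia.
  by exists S1; split=> // v; rewrite /= h //; lia.
- move=> k [s1 w1] kn [/= ag cnt off [S1 [mS1 SS1 S1p RS1]]] s1n s11 s1u s1w.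
  have [u uk] := rank_onto kn.
  apply: (@runs_seq _ _ _ 4); first by lia.
  apply: runs_ops => //=.
  set s2 := upd _ _ _.
  have s1F : s1 rFREE = F + n by rewrite ag.
  have s2T : s2 rT = 1 - (u \in S1).
    rewrite /s2; upds; rewrite s11 -mS1 uk; congr (_ - s1 _); lia.
  have s2E a : a != rT -> s2 a = s1 a by move=> ?; rewrite /s2; upds.
  have ag2 : agree d F r0 s2.
    by move=> a sa; rewrite s2E ?ag //; move: sa; rewrite /safe; lia.
  have mS2 : marks F S1 s2.
    by move=> x; rewrite s2E //; lia.
  have -> : 5 + (4 + n * (cost n f + 9)) - 4 = (4 + n * (cost n f + 9)).+1 by lia.
  apply: runs_unless => /=.
    rewrite s2T => resT; split; rewrite ?s2E //; try lia.
    split; rewrite ?s2E //; try lia.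
    exists S1; split=> // x v; rewrite ltnS leq_eqVlt => /orP[/eqP xk xS|xk]; last exact: RS1.
    have xu : x = u by apply: rank_inj; lia.
    by move: resT; rewrite -xu SS1.
  rewrite s2T => resT.
  have uS1 : u \in S1 by move: resT; case: (u \in S1).
  apply: runs_weaken (@runs_scan u S1 (s2, w1) uS1 S1p ag2 _ _ mS2) _ _ => //.
  + by rewrite /= s2E; lia.
  + by rewrite /= s2E ?uk; lia.
  move=> [s3 w3] /= [ag3 [S3 [mS3 S13 S3p RS3]]].
  split; try by rewrite ag3 ?s2E // /safe; lia.
  split=> /=.
  + by apply: (agree_trans ag2); apply: agreeW ag3.
  + by rewrite ag3 ?s2E // /safe; lia.
  + by rewrite ag3 ?s2E // /safe; lia.
  exists S3; split=> //; first by move=> x /SS1/S13.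
  move=> x v; rewrite ltnS leq_eqVlt => /orP[/eqP xk xS|xk xS Rxv]; last exact/S13/(RS1 x).
  by rewrite (_ : x = u); [exact: RS3 | apply: rank_inj; lia].
- move=> s1 [ag cnt off [S1 [mS1 SS1 S1p RS1]]]; split=> //; exists S1; split=> // u v.
  by apply: RS1; apply: rank_lt.
Qed.

End Reach.

(** A path without repetition has fewer edges than there are vertices, which is why [n] rounds
    saturate the marks. *)
Lemma path_of_connect (T : finType) (R : rel T) x y : connect R x y ->
  exists q, [/\ path R x q, last x q = y & size q < #|T|].
Proof.
case/connectP=> q0 q0p ->; case/shortenP: q0p => q qp uq _; exists q; split=> //.
by have := max_card (mem (x :: q)); rewrite (card_uniqP uq).
Qed.

Lemma correct_Reach d f i j : correct d.+2 f -> correct d (Reach f i j).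
Proof.
rewrite /correct /= => cf /and3P[id jd scf] dM e r w rdy.
have {}dM : 6 + 4 * (d.+2 + depth f) <= M by lia.
have [F FE] : exists F, F = r rFREE by exists (r rFREE).
set p := e i; rewrite -FE.
pose R u v := eval g d.+2 (setv (setv e d u) d.+1 v) f.
have [r1 rn rF rv _] := rdy.
have MF : M + n * n <= F by rewrite FE.
pose r0 := upd r rFREE (F + n).
have ag0 (a : nat) : a != rFREE -> r0 a = r a by move=> ?; rewrite /r0; upds.
have rdy0 : ready d e r0.
  case: rdy => h1 h2 h3 h4 h5; split=> [|||l ld|u v].
  - by rewrite ag0.
  - by rewrite ag0.
  - by rewrite /r0; upds; lia.
  - by rewrite !ag0; [exact: h4|lia|lia].
  - by rewrite ag0 //; lia.
have r0F : r0 rFREE = F + n by rewrite /r0; upds.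
have [r01 r0n _ r0v _] := rdy0.
apply: (@runs_seq _ _ _ 1); first by lia.
apply: runs_ops => //=; rewrite rn -FE -/r0.
apply: (@runs_seq _ _ _ (4 + n * 8)); first by lia.
pose Inv0 k (s : state) := agree d F r0 s.1 /\ forall u, rank u < k -> s.1 (F + rank u) = 0.
have loop0 := @runs_for (rval d) (rrow d) _ Inv0 n 4 (r0, w).
apply: runs_weaken (loop0 _ _ _ _ _ _ _ _ _) _ _ => //; clear loop0; try lia.
- move=> k s1 r' [ag z] h; split=> /=.
    by move=> a sa; rewrite -ag // h //; move: sa; rewrite /safe; lia.
  by move=> u uk; rewrite h ?z //; lia.
- move=> k [s1 w1] kn [/= ag z] s1n s11 s1v s1w.
  apply: runs_ops => //=.
  set s2 := upd _ _ _.
  have s1F : s1 rFREE = F + n by rewrite ag.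
  have s2E a : a != rT -> a != rU -> a != F + k -> s2 a = s1 a.
    by move=> aT aU aF; rewrite /s2; upds.
  have s2k : s2 (F + k) = 0 by rewrite /s2; upds.
  split; rewrite ?s2E //; try lia.
  split=> /=; first by move=> a sa; rewrite s2E ?ag //; move: sa; rewrite /safe; lia.
  move=> u; rewrite ltnS leq_eqVlt => /orP[/eqP ->//|uk].
  by rewrite s2E ?z //; lia.
move=> [s1 w1] [/= ag1 z1].
have {}z1 u : s1 (F + rank u) = 0 by apply: z1; apply: rank_lt.
apply: (@runs_seq _ _ _ 3); first by lia.
apply: runs_ops => //=.
set s2 := upd _ _ _.
have s1F : s1 rFREE = F + n by rewrite ag1.
have s1n : s1 rN = n by rewrite ag1.
have s1i : s1 (rval i) = rank p.
  by rewrite ag1 ?ag0; [case: (rv i id)|lia|rewrite /safe; lia].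
have s2E a : a != rT -> a != F + rank p -> s2 a = s1 a.
  by move=> aT aF; rewrite /s2; upds.
have s2p : s2 (F + rank p) = 1 by rewrite /s2; upds; rewrite ag1.
have ag2 : agree d F r0 s2.
  by move=> a sa; rewrite s2E ?ag1 //; move: sa; rewrite /safe; lia.
have mS2 : marks F [set p] s2.
  move=> u; rewrite inE; case: eqP => [->//|/eqP ne]; rewrite s2E ?z1 //; first by lia.
  by have : rank u != rank p; [rewrite (inj_eq rank_inj) | lia].
set T := 4 + n * ((5 + (4 + n * (cost n f + 9))) + 4).
apply: (@runs_seq _ _ _ (4 + n * (T + 4))); first by lia.
(* After [k] rounds the ends of all paths from [p] with at most [k] edges are marked, and only
   reachable vertices are. *)
pose Inv k (s : state) := agree d F r0 s.1 /\ exists S : {set V},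
  [/\ marks F S s.1, forall v, v \in S -> connect R p v
  & forall q, path R p q -> size q <= k -> last p q \in S].
have loop := @runs_for (rcnt d) (roff d) _ Inv n T (s2, w1).
apply: runs_weaken (loop _ _ _ _ _ _ _ _ _) _ _ => //; clear loop; try lia.
- by rewrite /= ag2.
- by rewrite /= ag2.
- split=> //; exists [set p]; split=> // [v|q].
    by rewrite inE => /eqP ->; apply: connect0.
  by case: q => //= _ _; rewrite inE.
- move=> k s3 r' [ag [S1 [mS1 S1p RS1]]] h; split=> /=.
    by move=> a sa; rewrite -ag // h //; move: sa; rewrite /safe; lia.
  by exists S1; split=> // v; rewrite /= h //; lia.
- move=> k [s3 w3] kn [/= ag [S1 [mS1 S1p RS1]]] s3n s31 s3v s3w.
  apply: runs_weaken (@runs_round d f e r0 F p cf scf dM rdy0 MF r0F S1 (s3, w3) _ _ _) _ _ => //.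
  move=> [s4 w4] /= [ag4 cnt off [S4 [mS4 S14 S4p RS4]]].
  split; rewrite ?cnt ?off //; try by rewrite ag4.
  split=> //; exists S4; split=> // q.
  case/lastP: q => [|q v]; first by move=> _ _; apply: S14; apply: (RS1 [::]).
  rewrite rcons_path size_rcons last_rcons ltnS => /andP[pq Rv] qk.
  by apply: RS4 Rv; apply: RS1.
move=> [s3 w3] [/= ag3 [S [/= mS Sp RS]]].
have s3F : s3 rFREE = F + n by rewrite ag3.
have s3n : s3 rN = n by rewrite ag3.
have s3j : s3 (rval j) = rank (e j).
  by rewrite ag3 ?ag0; [case: (rv j jd)|lia|rewrite /safe; lia].
apply: runs_ops => //=; first by lia.
split.
  (* The free pointer was advanced by [n] and has been set back; elsewhere [r0] equals [r]. *)
  move=> a sa; case: (eqVneq a rFREE) => [->|aF]; first by upds; lia.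
  by rewrite -ag0 // -ag3 //; move: sa; rewrite /safe => sa; upds.
upds; rewrite s3F s3n s3j addnK mS; congr nat_of_bool.
apply/idP/idP; first exact: Sp.
case/path_of_connect=> q [pq <- qn]; apply: RS => //.
by rewrite -cardV ltnW.
Qed.

Lemma code_correct d f : correct d f.
Proof.
elim: f d => *; [exact: correct_Adj | exact: correct_Eq | exact: correct_Not
  | exact: correct_And | exact: correct_Ex | exact: correct_Reach].
Qed.

End Code.

(** * Reading the graph *)

(** The base [n.+1] is positive, so exponents can be raised freely, and it is at most the length of
    the encoding of a graph with [n] vertices. *)
Definition poly_bounded (F : nat -> nat) : Prop :=
  exists c k, forall n, F n <= c * n.+1 ^ k.

Lemma poly_bounded_const c : poly_bounded (fun=> c).
Proof. by exists c, 0 => n; rewrite expn0 muln1. Qed.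

Lemma poly_bounded_id : poly_bounded id.
Proof. by exists 1, 1 => n; rewrite mul1n expn1. Qed.

Lemma poly_bounded_add F1 F2 :
  poly_bounded F1 -> poly_bounded F2 -> poly_bounded (fun n => F1 n + F2 n).
Proof.
move=> [c1 [k1 h1]] [c2 [k2 h2]]; exists (c1 + c2), (k1 + k2) => n.
rewrite mulnDl leq_add //.
  by apply: leq_trans (h1 n) _; rewrite leq_mul2l leq_pexp2l ?orbT // leq_addr.
by apply: leq_trans (h2 n) _; rewrite leq_mul2l leq_pexp2l ?orbT // leq_addl.
Qed.

Lemma poly_bounded_mul F1 F2 :
  poly_bounded F1 -> poly_bounded F2 -> poly_bounded (fun n => F1 n * F2 n).
Proof.
move=> [c1 [k1 h1]] [c2 [k2 h2]]; exists (c1 * c2), (k1 + k2) => n.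
by rewrite expnD mulnACA leq_mul.
Qed.

Ltac poly_bound := repeat first
  [ assumption | apply: poly_bounded_id | apply: poly_bounded_const
  | apply: poly_bounded_add | apply: poly_bounded_mul ].

Lemma cost_poly f : poly_bounded (cost^~ f).
Proof. by elim: f => *; rewrite /=; poly_bound. Qed.

(** The first loop adds up the unary digits and stops after reading the 0. The nested loops only
    serve to store [n * n] bits in sequence, which leaves the free pointer just past the matrix. *)
Definition read_graph (M : nat) : cmd :=
  Seq (Ops [:: Iconst rONE 1; Iconst rN 0])
 (Seq (Do (Ops [:: Iread rT; Iadd rN rN rT]) rT)
 (Seq (Ops [:: Iconst rFREE M])
      (For (rval 0) (rrow 0) (For (rval 1) (rrow 1)
        (Ops [:: Iread rT; Istore rFREE rT; Iadd rFREE rFREE rONE]))))).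

Definition read_cost (n : nat) : nat := 2 + (n.+1 * 3 + (1 + (4 + n * (4 + n * 7 + 4)))).

Lemma runs_read M n bits : 14 <= M -> size bits = n * n ->
  runs (read_graph M) (fun=> 0, nseq n true ++ false :: bits) (read_cost n)
    (fun s => [/\ s.1 rONE = 1, s.1 rN = n, s.1 rFREE = M + n * n &
       forall i, i < n * n -> s.1 (M + i) = nth false bits i]).
Proof.
move=> M14 szb; rewrite /read_cost.
apply: (@runs_seq _ _ _ 2); first by lia.
apply: runs_ops => //=; set r0 := upd _ _ _.
set w0 := _ ++ _.
apply: (@runs_seq _ _ _ (n.+1 * 3)); first by lia.
(* The loop makes [n.+1] reads, the last of which is the terminating 0; hence [minn k n]. *)
pose Inv k (s : state) := [/\ s.1 rONE = 1, s.1 rN = minn k n & s.2 = drop k w0].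
apply: runs_weaken (runs_do (Inv := Inv) (T := 2) (n := n.+1) _ _ _) _ _ => //.
- by split; rewrite ?drop0 ?min0n.
- move=> k [r w] kn [/= r1 rn wE].
  apply: runs_ops => //=.
  have -> : head false w = (k < n).
    rewrite wE -nth0 nth_drop addn0 /w0 nth_cat size_nseq nth_nseq.
    by case: ltnP => // nk; have -> : k - n = 0 by lia.
  split; last by rewrite ltnS; upds; case: (k < n).
  split=> /=; first by upds.
    by upds; rewrite rn; lia.
  by rewrite wE -drop1 drop_drop add1n.
move=> [r w] [/= r1 rn wE].
have {wE}-> : w = bits.
  by rewrite wE /w0 drop_cat size_nseq ltnNge leqnSn /= subSnn /= drop0.
apply: (@runs_seq _ _ _ 1); first by lia.
apply: runs_ops => //=; set r2 := upd _ _ _.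
pose Inv2 k (s : state) := [/\ s.1 rONE = 1, s.1 rN = n, s.1 rFREE = M + k,
  s.2 = drop k bits & forall i, i < k -> s.1 (M + i) = nth false bits i].
have bits_step k s : k < n * n -> Inv2 k s ->
    runs (Ops [:: Iread rT; Istore rFREE rT; Iadd rFREE rFREE rONE]) s 3
      (fun s' => Inv2 k.+1 s' /\ forall a, 6 <= a < M -> s'.1 a = s.1 a).
  move: s => [r3 w3] kn [/= h1 h2 h3 h4 h5].
  apply: runs_ops => //=; split; last by move=> a aM; upds.
  split=> /=; try by upds; lia.
    by rewrite h4 -drop1 drop_drop add1n.
  move=> i; rewrite ltnS leq_eqVlt => /orP[/eqP ->|ik].
    by upds; rewrite h4 -nth0 nth_drop addn0.
  by upds; rewrite h5.
have stable v w' k s r' : 5 < v < M -> 5 < w' < M -> Inv2 k s ->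
    (forall a : nat, a != v -> a != w' -> a != rT -> r' a = s.1 a) -> Inv2 k (r', s.2).
  move=> vM wM [h1 h2 h3 h4 h5] h; split=> //=; try by rewrite h //; lia.
  by move=> i ik; rewrite h ?h5 //; lia.
have outer := @runs_for (rval 0) (rrow 0) _ (fun k => Inv2 (k * n)) n (4 + n * 7).
apply: runs_weaken (outer _ (r2, bits) _ _ _ _ _ _ _ _) _ _ => //=; clear outer.
- by rewrite /r2; upds; rewrite rn; lia.
- split=> //=; try by rewrite /r2; upds; rewrite ?rn; lia.
  by rewrite mul0n drop0.
- by move=> k s r' Is h; apply: stable Is h; lia.
- move=> k s kn Is sN s1 sv sw.
  pose Inv3 j (s' : state) := [/\ Inv2 (k * n + j) s',
     s'.1 (rval 0) = k & s'.1 (rrow 0) = k * n].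
  have inner := @runs_for (rval 1) (rrow 1) _ Inv3 n 3 s.
  apply: runs_weaken (inner _ _ _ _ _ _ _ _ _) _ _ => //; clear inner.
  + by split; rewrite ?addn0.
  + move=> j s' r' [I2 v0 w0'] h; split; last 2 first.
    * by rewrite /= h.
    * by rewrite /= h.
    by apply: stable I2 h; lia.
  + move=> j s' jn [I2 v0 w0'] s'N s'1 s'v s'w.
    have kj : k * n + j < n * n.
      have : k.+1 * n <= n * n by rewrite leq_mul2r kn orbT.
      by rewrite mulSn; lia.
    apply: runs_weaken (bits_step _ _ kj I2) _ _ => //.
    move=> s2 [[g1 g2 g3 g4 g5] ag].
    have agE a : 5 < a < 14 -> s2.1 a = s'.1 a by move=> ?; apply: ag; lia.
    split=> //; try by rewrite agE.
    by split; rewrite ?addnS ?agE.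
  move=> s' [[g1 g2 g3 g4 g5] v0 w0'].
  by split=> //; rewrite mulSn addnC; split.
- by rewrite /=; lia.
by move=> s [].
Qed.

Lemma nth_allpairs (S T R : Type) (f : S -> T -> R) x0 y0 z0 s t i j :
  i < size s -> j < size t ->
  nth z0 [seq f x y | x <- s, y <- t] (i * size t + j) = f (nth x0 s i) (nth y0 t j).
Proof.
elim: s i => [|x s IH] [|i] //= si tj; rewrite nth_cat size_map.
  by rewrite mul0n add0n tj (nth_map y0).
rewrite mulSn -addnA ltnNge leq_addr /= addKn; exact: IH.
Qed.

(** For [n = 0] there is no vertex to build an environment from, so the formula is skipped and the
    answer is 0. *)
Definition decide (M : nat) (f : form) : cmd :=
  Seq (read_graph M)
 (Seq (Ops [:: Iconst rRES 0; Isub rT rONE rN]) (Unless rT (code M 0 f))).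

Lemma runs_decide (G : sgraph) M f (b : bool) : 14 <= M -> 6 + 4 * depth f <= M ->
  well_scoped 0 f -> (b -> exists v : G, true) ->
  (forall e : nat -> G, eval (@adj G) 0 e f = b) ->
  runs (decide M f) (fun=> 0, encode_graph G) (read_cost #|G| + (2 + (cost #|G| f).+1))
    (fun s => s.1 rRES = b).
Proof.
move=> M14 dM sc b0 ev.
have [n cardG] : exists n, #|G| = n by exists #|G|.
rewrite /encode_graph cardG.
set bits := [seq _ | x <- _, y <- _].
have szb : size bits = n * n by rewrite size_allpairs -cardE cardG.
apply: (@runs_seq _ _ _ (read_cost n)); first by lia.
apply: runs_weaken (runs_read M14 szb) _ _ => //.
move=> [r w] [/= r1 rn rF rg].
apply: (@runs_seq _ _ _ 2); first by lia.
apply: runs_ops => //=; set r2 := upd _ _ _.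
have r2T : r2 rT = 1 - n by rewrite /r2; upds; rewrite r1 rn.
have r2E (a : nat) : a != rRES -> a != rT -> r2 a = r a by move=> *; rewrite /r2; upds.
rewrite addKn addKn.
apply: runs_unless => /=; rewrite r2T => n0.
  rewrite /r2; upds; case: b b0 {ev} => // /(_ isT) [v _].
  have : 0 < #|G| by apply/card_gt0P; exists v.
  by rewrite cardG; lia.
have [v0 _] : exists v : G, v \in G by apply/card_gt0P; rewrite cardG; lia.
have rdy : ready (@adj G) n M 0 (fun=> v0) r2.
  split; rewrite ?r2E ?rF //; try by lia.
  move=> u v; have := rank_lt cardG u; have := rank_lt cardG v => vn un.
  have un' : (rank u).+1 * n <= n * n by rewrite leq_mul2r un orbT.
  rewrite r2E; [|lia|lia]; rewrite rg; last by rewrite mulSn in un'; lia.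
  have szG : size (enum G) = n by rewrite -cardE.
  rewrite -{1}szG /bits (@nth_allpairs _ _ _ _ v0 v0) ?szG ?(rank_lt cardG) //.
  by rewrite /rank !nth_enum_rank.
apply: runs_weaken (@code_correct _ _ n M cardG 0 f sc dM _ _ w rdy) _ _ => //.
move=> s [_ ->]; by rewrite ev.
Qed.

(** * Formulas are decidable in polynomial time *)

Lemma run_mono P t t' s b : run P t s = Some b -> t <= t' -> run P t' s = Some b.
Proof.
elim: t t' s => // t IH [|t'] s //=; case: (step P s) => // s' rt tt'.
exact: IH rt tt'.
Qed.

Theorem polytime_formula f (Q : sgraph -> Prop) : well_scoped 0 f ->
  (forall G, Q G -> exists v : G, true) ->
  (forall (G : sgraph) (e : nat -> G), Q G <-> eval (@adj G) 0 e f) ->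
  polytime_decidable encode_graph Q.
Proof.
(* Reading the graph uses registers below 14, and the formula those below [6 + 4 * depth f]; the
   matrix starts above both. *)
move=> sc Q0 Qf; pose M := 14 + 4 * depth f.
pose p := compile 0 (decide M f).
(* A positive result jumps over the rejecting instruction to the accepting one. *)
pose P := p ++ [:: Ijump (size p).+2 rRES; Ihalt false; Ihalt true].
have [c [k ck]] : poly_bounded (fun n => read_cost n + (2 + (cost n f).+1) + 2).
  have cf := cost_poly f; rewrite /read_cost.
  suff : poly_bounded (fun n => 2 + ((1 + n) * 3 + (1 + (4 + n * (4 + n * 7 + 4))))
            + (2 + (1 + cost n f)) + 2) by [].
  by poly_bound.
exists P, c, k => G.
have [b bQ] : exists b : bool, b <-> Q G.
  have [n0|/card_gt0P[v _]] := posnP #|G|.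
    exists false; split=> // /Q0 [v _].
    by move: (max_card (pred1 v)); rewrite n0 card1.
  exists (eval (@adj G) 0 (fun=> v) f).
  by rewrite -Qf.
exists b => //.
have [|||e|s [t [ex tT res]]] := @runs_decide G M f b _ _ sc.
- by rewrite /M; lia.
- by rewrite /M; lia.
- by move/bQ/Q0.
- by apply/idP/idP => [/Qf/bQ|/bQ/Qf].
(* The two further steps are the final jump and the halt. *)
apply: (@run_mono _ (t + 2)); last first.
  apply: leq_trans (leq_trans (ck #|G|) _); first by lia.
  apply: leq_trans (leq_addr _ _).
  rewrite leq_mul2l; apply/orP; right.
  have encG : #|G| < size (encode_graph G).
    by rewrite size_cat size_nseq /= addnS ltnS leq_addr.
  by elim: {tT ck} k => // k IH; rewrite !expnS leq_mul.
have := run_compile ex [::] [:: Ijump (size p).+2 rRES; Ihalt false; Ihalt true] 2.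
rewrite /= -/p -/P add0n => ->.
have nthP i : nth (Ihalt false) P (size p + i) =
    nth (Ihalt false) [:: Ijump (size p).+2 rRES; Ihalt false; Ihalt true] i.
  by rewrite nth_cat ltnNge leq_addr addKn.
have := nthP 0; rewrite addn0 /= => ->; rewrite res.
have := nthP 1; have := nthP 2; rewrite addn1 addn2 /= => n2 n1.
by case: b {bQ res}; rewrite /= ?n1 ?n2.
Qed.

(** * The house criterion as a formula *)

Definition nonneighbour_formula (v : nat) : form := And (Not (Eq v 0)) (Not (Adj 0 v)).

(** Below the six quantifiers of [house_formula] the depth is 6, so 6 and 7 are the source and
    target of the edge relation. *)
Definition same_component_formula (u v : nat) : form :=
  Reach (And (Adj 6 7) (And (nonneighbour_formula 6) (nonneighbour_formula 7))) u v.

(* The variables 0, ..., 5 stand for b, c, x, p, q, y in [house_witness]. *)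
Definition house_formula : form :=
  Ex (Ex (Ex (Ex (Ex (Ex
    (And (Adj 0 1) (And (Adj 0 2) (And (Not (Eq 1 2)) (And (Not (Adj 1 2))
    (And (Adj 2 3) (And (Adj 2 4) (And (Not (Eq 3 4)) (And (Not (Adj 1 3))
    (And (Adj 1 5) (And (nonneighbour_formula 3)
    (And (same_component_formula 3 4) (same_component_formula 3 5))))))))))))))))).

Lemma eval_house_formula (G : sgraph) (e : nat -> G) :
  eval (@adj G) 0 e house_formula =
  [exists b : G, exists c, exists x, exists p, exists q, exists y,
    house_witness b c x p q y].
Proof.
rewrite /=; do 6!apply: eq_existsb => ?.
rewrite /house_witness !in_component /setv /= inE.
by do 10!congr (_ && _); congr (_ && _); apply: eq_connect => u v; rewrite !inE.
Qed.

Theorem theorem1p9 :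
  polytime_decidable encode_graph (fun G : sgraph => induced_minor house G).
Proof.
have witnessP (G : sgraph) : induced_minor house G <->
  [exists b : G, exists c, exists x, exists p, exists q, exists y,
    house_witness b c x p q y].
  split=> [/house_minorP [b [c [x [p [q [y w]]]]]]|].
    by apply/existsP; exists b; apply/existsP; exists c; apply/existsP; exists x;
      apply/existsP; exists p; apply/existsP; exists q; apply/existsP; exists y.
  case/existsP=> b /existsP[c /existsP[x /existsP[p /existsP[q /existsP[y w]]]]].
  by apply/house_minorP; exists b, c, x, p, q, y.
apply: (@polytime_formula house_formula _ isT) => [G|G e].
  by case/witnessP/existsP=> b _; exists b.
by rewrite eval_house_formula; exact: witnessP.
Qed.
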